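(* Let $(K,v)$ be a valued field of mixed characteristic $(0,p)$. The following are equivalent: (i) $\mathcal{O}_v/p\mathcal{O}_v$ is semi-perfect and $v(p)$ is not minimal positive in $vK$; (ii) for every (possibly trivial) elementary extension $(K^*,v^* )\succcurlyeq(K,v)$, the residue field $K^*v^*_p$ is perfect and the value group $\overline{v^*}(K^*v^*_0)$ is $p$-divisible; (iii) for some $\aleph_1$-saturated elementary extension $(K^*,v^* )\succcurlyeq(K,v)$, the residue field $K^*v^*_p$ is perfect and the value group $\overline{v^*_p}(K^*v^*_0)$ is $p$-divisible.
   Context: For a valued field $(K^*,v^* )$ of mixed characteristic $(0,p)$: $v^*_0$ is the finest coarsening of $v^*$ with $v^*_0(p)=0$ (corresponding to the convex hull of $\mathbb{Z}v^*(p)$), $v^*_p$ is the coarsest coarsening with $v^*_p(p)>0$ (corresponding to the largest convex subgroup of $v^*K^*$ not containing $v^*(p)$); $\overline{v^*}$ denotes the valuation induced by $v^*$ on the residue field $K^*v^*_0$ and $\overline{v^*_p}$ the valuation induced by $v^*_p$ on $K^*v^*_0$; $K^*v^*_p$ is the residue field of $v^*_p$. A coarsening of $v$ is a valuation $w$ with $\mathcal{O}_v\subseteq \mathcal{O}_w$. A ring of characteristic $p$ is semi-perfect if its Frobenius map is surjective. Elementary extensions and saturation are with respect to the valued field structure (language of rings with a predicate for the valuation ring). *)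

(* Defs.v *)
From HB Require Import structures.
From mathcomp Require Import all_boot all_order all_algebra.
From mathcomp Require Import ring_quotient generic_quotient.
From mathcomp Require Import boolp classical_sets cardinality.

Set Implicit Arguments.
Unset Strict Implicit.
Unset Printing Implicit Defensive.

Import Order.TTheory GRing.Theory.
Local Open Scope quotient_scope.
Local Open Scope ring_scope.

(* Totality is a field here because a join of [Order.Total] and [GRing.Zmodule]
   can no longer be declared once [Num.RealDomain] exists. *)
HB.mixin Record POrderedZmodule_isOrderedGroup (G : Type)
    of Num.POrderedZmodule G := {
  oag_le_total : total (<=%R : rel G);
  oag_leD2l : forall z x y : G, x <= y -> z + x <= z + y
}.

#[short(type="oagType")]
HB.structure Definition OrderedGroup :=
  {G of Num.POrderedZmodule G & POrderedZmodule_isOrderedGroup G}.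

Section OagTheory.
Variable G : oagType.
Implicit Types x y z : G.

Lemma oag_comparable x y : Order.comparable x y.
Proof. exact: oag_le_total. Qed.

Lemma oag_leNgt x y : (x <= y) = ~~ (y < x).
Proof. exact/comparable_leNgt/oag_comparable. Qed.

Lemma oag_ltNge x y : (x < y) = ~~ (y <= x).
Proof. exact/comparable_ltNge/oag_comparable. Qed.

Lemma oag_leVge x y : {x <= y} + {y < x}.
Proof.
by case: (boolP (x <= y)) => [|h]; [left | right; rewrite oag_ltNge].
Qed.

Lemma oag_leD2lE z x y : (z + x <= z + y) = (x <= y).
Proof.
apply/idP/idP => [/(oag_leD2l (- z))|]; last exact: oag_leD2l.
by rewrite !addKr.
Qed.

Lemma oag_leD2rE z x y : (x + z <= y + z) = (x <= y).
Proof. by rewrite ![_ + z]addrC oag_leD2lE. Qed.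

Lemma oag_leD x y z t : x <= y -> z <= t -> x + z <= y + t.
Proof.
move=> xy zt; apply: (@le_trans _ _ (y + z)).
  by rewrite oag_leD2rE.
by rewrite oag_leD2lE.
Qed.

Lemma oag_leN2 x y : (- x <= - y) = (y <= x).
Proof. by rewrite -(oag_leD2lE (x + y) (- x)) addrK addrAC addrN add0r. Qed.

Lemma oag_subr_ge0 x y : (0 <= y - x) = (x <= y).
Proof. by rewrite -(oag_leD2rE x 0) add0r subrK. Qed.

Lemma oag_oppr_le0 x : (- x <= 0) = (0 <= x).
Proof. by rewrite -[X in _ = X]oag_leN2 oppr0. Qed.

Lemma oag_oppr_ge0 x : (0 <= - x) = (x <= 0).
Proof. by rewrite -[X in _ = X]oag_leN2 oppr0. Qed.

End OagTheory.

Definition min_positive (G : oagType) (g : G) :=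
  0 < g /\ forall h : G, 0 < h -> g <= h.

Definition pdivisible (p : nat) (G : zmodType) :=
  forall g : G, exists h : G, h *+ p = g.

Section Subgroup.
Variables (G : oagType) (H : zmodClosed G).

Record subgroup := Subgroup { sg_val : G; _ : sg_val \in H }.

HB.instance Definition _ := [isSub for sg_val].
HB.instance Definition _ := [Choice of subgroup by <:].
HB.instance Definition _ := [SubChoice_isSubZmodule of subgroup by <:].
HB.instance Definition _ :=
  [SubChoice_isSubPOrder of subgroup by <: with ring_display].

Fact subgroup_le_total : total (<=%R : rel subgroup).
Proof. by move=> x y; rewrite !leEsub oag_le_total. Qed.

Fact subgroup_leD2l (z x y : subgroup) : x <= y -> z + x <= z + y.
Proof. by rewrite !leEsub !raddfD /= oag_leD2lE. Qed.

HB.instance Definition _ := POrderedZmodule_isOrderedGroup.Build subgroup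
  subgroup_le_total subgroup_leD2l.

End Subgroup.

HB.mixin Record isConvex (G : oagType) (D : G -> bool) := {
  convex_subproof :
    forall x y z : G, x \in (D : {pred G}) -> z \in (D : {pred G}) ->
      x <= y <= z -> y \in (D : {pred G})
}.

#[short(type="convexSubgroup")]
HB.structure Definition ConvexSubgroup (G : oagType) :=
  {D of GRing.ZmodClosed G D & isConvex G D}.

Lemma convexP (G : oagType) (D : convexSubgroup G) (x y z : G) :
  x \in D -> z \in D -> x <= y <= z -> y \in D.
Proof. exact: convex_subproof. Qed.

Section ConvexQuotient.
Variables (G : oagType) (D : convexSubgroup G).

Definition gquot := Quotient.quot D.
HB.instance Definition _ := ZmodQuotient.on gquot.

(* The order of a quotient by a convex subgroup can be read off arbitrary
   representatives; see [gquot_le_pi]. *)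
Definition gquot_le (a b : gquot) := (repr a <= repr b)%R.

Fact gquot_le_refl : reflexive gquot_le.
Proof. by move=> a; rewrite /gquot_le. Qed.

Fact gquot_le_anti : antisymmetric gquot_le.
Proof. by move=> a b /le_anti e; rewrite -[a]reprK -[b]reprK e. Qed.

Fact gquot_le_trans : transitive gquot_le.
Proof. by move=> b a c; apply: le_trans. Qed.

Fact gquot_le_total : total gquot_le.
Proof. by move=> a b; apply: oag_le_total. Qed.

HB.instance Definition _ := Order.Le_isPOrder.Build ring_display gquot
  gquot_le_refl gquot_le_anti gquot_le_trans.

Lemma gquot_eqE (x y : G) : (\pi_gquot x == \pi_gquot y) = (x - y \in D).
Proof. by rewrite -Quotient.idealrBE. Qed.

Lemma gquot_le_pi (x y : G) : x <= y -> \pi_gquot x <= \pi_gquot y.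
Proof.
move=> xy; rewrite /Order.le /= /gquot_le oag_leNgt; apply/negP => lt_yx.
move: lt_yx; set y' := repr _; set x' := repr _ => lt_yx.
have Dx : x' - x \in D by rewrite -gquot_eqE reprK.
have Dy : y' - y \in D by rewrite -gquot_eqE reprK.
suff Dxy : x' - y' \in D.
  move: Dxy; rewrite -gquot_eqE !reprK => /eqP e.
  by move: lt_yx; rewrite /x' /y' e ltxx.
have Dd : (x' - x) - (y' - y) \in D by rewrite rpredB.
apply: convexP (rpred0 D) Dd _; rewrite oag_subr_ge0 (ltW lt_yx) /=.
have -> : x' - y' = (x - y) + ((x' - x) - (y' - y)).
  by rewrite opprB addrACA addKr [x + _]addrC subrK.
by rewrite -[leRHS]add0r oag_leD2rE -(oag_leD2rE y) subrK add0r.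
Qed.

Lemma gquot_ge0E (x : G) : (0 <= \pi_gquot x) = (0 <= x) || (x \in D).
Proof.
have pi0 : \pi_gquot 0 = 0 :> gquot by apply: raddf0.
have [x0|x0] := oag_leVge 0 x; first by rewrite x0 -pi0 gquot_le_pi.
rewrite [0 <= x]oag_leNgt x0 /= -pi0.
have le0 : \pi_gquot x <= \pi_gquot 0 by rewrite gquot_le_pi ?ltW.
have <- : (\pi_gquot x == \pi_gquot 0) = (x \in D) by rewrite gquot_eqE subr0.
by rewrite eq_le le0.
Qed.

Fact gquot_leD2l (c a b : gquot) : a <= b -> c + a <= c + b.
Proof.
move=> ab; rewrite -[a]reprK -[b]reprK -[c]reprK -!raddfD.
by apply: gquot_le_pi; rewrite oag_leD2lE.
Qed.

HB.instance Definition _ := POrderedZmodule_isOrderedGroup.Build gquot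
  gquot_le_total gquot_leD2l.

End ConvexQuotient.

Section ConvexHull.
Variables (G : oagType) (g : G).

Definition in_cvx_hull (x : G) : bool :=
  `[< exists a b : int, g *~ a <= x <= g *~ b >].

Fact cvx_hull_zmod : zmod_closed in_cvx_hull.
Proof.
split=> [|x y /asboolP[a [b /andP[ax xb]]] /asboolP[c [d /andP[cy yd]]]].
  by apply/asboolP; exists 0, 0; rewrite mulr0z lexx.
apply/asboolP; exists (a - d), (b - c); rewrite !mulrzBr.
by rewrite !oag_leD ?oag_leN2.
Qed.

Fact cvx_hull_convex (x y z : G) : x \in (in_cvx_hull : {pred G}) ->
  z \in (in_cvx_hull : {pred G}) -> x <= y <= z -> y \in (in_cvx_hull : {pred G}).
Proof.
move=> /asboolP[a [_ /andP[ax _]]] /asboolP[_ [d /andP[_ zd]]] /andP[xy yz].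
by apply/asboolP; exists a, d; rewrite (le_trans ax xy) (le_trans yz zd).
Qed.

HB.instance Definition _ := GRing.isZmodClosed.Build G in_cvx_hull cvx_hull_zmod.
HB.instance Definition _ := isConvex.Build G in_cvx_hull cvx_hull_convex.

Definition cvx_hull : convexSubgroup G := ConvexSubgroup.clone G in_cvx_hull _.

Lemma cvx_hull_id : g \in cvx_hull.
Proof. by apply/asboolP; exists 1, 1; rewrite mulr1z lexx. Qed.

Lemma cvx_hull_min (D : convexSubgroup G) :
  g \in D -> {subset cvx_hull <= D}.
Proof.
move=> Dg x /asboolP[a [b axb]].
have Dz (c : int) : g *~ c \in D by rewrite rpredMz.
exact: convexP (Dz a) (Dz b) axb.
Qed.

End ConvexHull.

Lemma convex_chain (G : oagType) (D E : convexSubgroup G) :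
  {subset D <= E} \/ {subset E <= D}.
Proof.
have [DE|/existsNP[x /not_implyP[Dx Ex]]] := pselect {subset D <= E}; first by left.
right=> y Ey.
wlog x0 : x Dx Ex / 0 <= x => [th|].
  have [/th|x0] := oag_leVge 0 x; first exact.
  by apply: (th (- x)); rewrite ?rpredN ?oag_oppr_ge0 ?ltW.
have small z : z \in E -> z <= x.
  move=> Ez; rewrite oag_leNgt; apply/negP => xz; apply: Ex.
  by apply: convexP (rpred0 E) Ez _; rewrite x0 ltW.
have DNx : - x \in D by rewrite rpredN.
apply: convexP DNx Dx _; rewrite small // andbT -oag_leN2 opprK small //.
by rewrite rpredN.
Qed.

Section LargestConvex.
Variables (G : oagType) (g : G).

(* The largest convex subgroup not containing [g]; the first disjunct only
   serves to get the trivial subgroup in the degenerate case [g = 0]. *)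
Definition in_max_cvx (x : G) : bool :=
  (x == 0) || `[< exists2 D : convexSubgroup G, x \in D & g \notin D >].

Fact max_cvx_zmod : zmod_closed in_max_cvx.
Proof.
have N x : x \in (in_max_cvx : {pred G}) -> - x \in (in_max_cvx : {pred G}).
  move=> /orP[/eqP->|/asboolP[D Dx Dg]]; rewrite unfold_in /in_max_cvx.
    by rewrite oppr0 eqxx.
  by apply/orP; right; apply/asboolP; exists D; rewrite ?rpredN.
split=> [|x y /[dup] mx /orP[/eqP-> /N|/asboolP[D Dx Dg]]].
- by rewrite unfold_in /in_max_cvx eqxx.
- by rewrite sub0r.
move=> /orP[/eqP->|/asboolP[E Ey Eg]]; first by rewrite subr0.
rewrite unfold_in /in_max_cvx; apply/orP; right; apply/asboolP.
have [DE|ED] := convex_chain D E.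
  by exists E; rewrite // rpredB // DE.
by exists D; rewrite // rpredB // ED.
Qed.

Fact max_cvx_convex (x y z : G) : x \in (in_max_cvx : {pred G}) ->
  z \in (in_max_cvx : {pred G}) -> x <= y <= z -> y \in (in_max_cvx : {pred G}).
Proof.
move=> mx mz xyz; have [y0|y0] := eqVneq y 0.
  by rewrite unfold_in /in_max_cvx y0 eqxx.
suff [D [Dx Dz Dg]] : exists D : convexSubgroup G, [/\ x \in D, z \in D & g \notin D].
  rewrite unfold_in /in_max_cvx; apply/orP; right; apply/asboolP.
  by exists D => //; apply: convexP Dx Dz xyz.
move: mx mz => /orP[/eqP x0|/asboolP[D Dx Dg]] /orP[/eqP z0|/asboolP[E Ez Eg]].
- by move: xyz y0; rewrite x0 z0 => /le_anti ->; rewrite eqxx.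
- by exists E; rewrite x0 rpred0.
- by exists D; rewrite z0 rpred0.
have [DE|ED] := convex_chain D E; first by exists E; split; rewrite // DE.
by exists D; split; rewrite // ED.
Qed.

HB.instance Definition _ := GRing.isZmodClosed.Build G in_max_cvx max_cvx_zmod.
HB.instance Definition _ := isConvex.Build G in_max_cvx max_cvx_convex.

Definition max_cvx : convexSubgroup G := ConvexSubgroup.clone G in_max_cvx _.

Lemma max_cvx_notin : g != 0 -> g \notin max_cvx.
Proof.
move=> g0; rewrite unfold_in /= /in_max_cvx (negPf g0) /=.
by apply/asboolP => -[D ->].
Qed.

Lemma max_cvx_max (D : convexSubgroup G) :
  g \notin D -> {subset D <= max_cvx}.
Proof.
by move=> Dg x Dx; apply/orP; right; apply/asboolP; exists D.
Qed.

Lemma max_cvx_hull : {subset max_cvx <= cvx_hull g}.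
Proof.
move=> x /orP[/eqP->|/asboolP[D Dx Dg]]; first exact: rpred0.
have [/(_ _ Dx)//|] := convex_chain D (cvx_hull g).
by move=> /(_ _ (cvx_hull_id g)); rewrite (negPf Dg).
Qed.

End LargestConvex.

(* [option G] stands for G with an element [None] = oo added on top. *)
Section ExtendedGroup.
Variable G : oagType.
Implicit Types a b : option G.

Definition eadd a b : option G :=
  match a, b with
  | Some x, Some y => Some (x + y)
  | _, _ => None
  end.

Definition ele a b : bool :=
  match a, b with
  | _, None => true
  | None, Some _ => false
  | Some x, Some y => x <= y
  end.

Definition elt a b : bool := ~~ ele b a.

Definition emin a b : option G := if ele a b then a else b.

Lemma ele_refl a : ele a a. Proof. by case: a => [x|] //=. Qed.

Lemma ele_total a b : ele a b || ele b a.
Proof. by case: a b => [x|] [y|] //=; apply: oag_le_total. Qed.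

Lemma ele_trans a b c : ele a b -> ele b c -> ele a c.
Proof. by case: a b c => [x|] [y|] [z|] //=; apply: le_trans. Qed.

Lemma elt_le a b : elt a b -> ele a b.
Proof. by move=> ab; have := ele_total a b; rewrite orbC (negPf ab). Qed.

Lemma elt_le_trans a b c : elt a b -> ele b c -> elt a c.
Proof. by move=> ab bc; apply: contra ab; apply: ele_trans bc. Qed.

Lemma ele_emin c a b : ele c a -> ele c b -> ele c (emin a b).
Proof. by rewrite /emin; case: ifP. Qed.

Lemma elt_emin c a b : elt c a -> elt c b -> elt c (emin a b).
Proof. by rewrite /emin; case: ifP. Qed.

End ExtendedGroup.

Record valuation (K : fieldType) := Valuation {
  vgroup : oagType;
  vfun :> K -> option vgroup;
  val_eq0 : forall x, vfun x = None <-> x = 0;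
  valM : forall x y, vfun (x * y) = eadd (vfun x) (vfun y);
  valD : forall x y, ele (emin (vfun x) (vfun y)) (vfun (x + y));
  val_surj : forall g, exists x, vfun x = Some g
}.

Section ValuationRing.
Variables (K : fieldType) (v : valuation K).
Implicit Types x y : K.

Lemma val0 : v 0 = None. Proof. exact/val_eq0. Qed.

Lemma val_neq0 x : x != 0 -> exists g, v x = Some g.
Proof.
by case E: (v x) => [g|] x0; [exists g | move/val_eq0: E x0 => ->; rewrite eqxx].
Qed.

Lemma val1 : v 1 = Some 0.
Proof.
have [g vg] := val_neq0 (oner_neq0 K).
have := valM v 1 1; rewrite mulr1 vg => -[] /eqP.
by rewrite -subr_eq0 opprD addrA subrr sub0r oppr_eq0 => /eqP ->.
Qed.

Lemma valN x : v (- x) = v x.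
Proof.
have [g vg] : exists g, v (-1) = Some g by apply: val_neq0; rewrite oppr_eq0 oner_eq0.
have g0 : g = 0.
  have := valM v (-1) (-1); rewrite mulrNN mulr1 val1 vg => -[] gg.
  apply/eqP; rewrite eq_le; case/orP: (oag_le_total 0 g) => h; rewrite h ?andbT /=.
    by rewrite gg -[leLHS]addr0 oag_leD2lE.
  by rewrite gg -[leRHS]addr0 oag_leD2lE.
by rewrite -mulN1r valM vg g0; case: (v x) => //= h; rewrite add0r.
Qed.

Lemma valV x g : v x = Some g -> v x^-1 = Some (- g).
Proof.
move=> vg; have x0 : x != 0 by apply/eqP => /(val_eq0 v); rewrite vg.
have [h vh] : exists h, v x^-1 = Some h by apply: val_neq0; rewrite invr_eq0.
have := valM v x x^-1; rewrite mulfV // val1 vg vh => -[] /eqP.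
by rewrite eq_sym addrC addr_eq0 => /eqP ->.
Qed.

Lemma valXz x g (a : int) : v x = Some g -> v (x ^ a) = Some (g *~ a).
Proof.
move=> vx; have valX n : v (x ^+ n) = Some (g *+ n).
  elim: n => [|n IH]; first by rewrite expr0 val1.
  by rewrite exprS valM vx IH /= mulrS.
by case: a => n; [exact: valX | exact: valV (valX _)].
Qed.

Definition vint : {pred K} := fun x => ele (Some 0) (v x).

Fact vint_subring : subring_closed vint.
Proof.
split=> [|x y vx vy|x y vx vy]; first by rewrite unfold_in /vint val1 ele_refl.
  rewrite unfold_in /vint; apply: ele_trans (valD v x (- y)).
  by apply: ele_emin; rewrite ?valN.
move: vx vy; rewrite !unfold_in /vint valM; case: (v x) (v y) => [g|] [h|] //=.
by move=> g0 h0; rewrite -[X in X <= _]addr0 oag_leD.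
Qed.

HB.instance Definition _ := GRing.isSubringClosed.Build K vint vint_subring.

Record vring := VRing { vring_val :> K; _ : vring_val \in vint }.

HB.instance Definition _ := [isSub for vring_val].
HB.instance Definition _ := [Choice of vring by <:].
HB.instance Definition _ := [SubChoice_isSubComNzRing of vring by <:].

Implicit Types a b : vring.

Definition vmax : {pred vring} := fun a => elt (Some 0) (v (vring_val a)).

Fact vmax_idealr : idealr_closed vmax.
Proof.
split; rewrite ?unfold_in /vmax /=.
- by rewrite val0.
- by rewrite val1 /elt ele_refl.
move=> a x y; rewrite /in_mem /= => vx vy.
apply: elt_le_trans (valD v _ _); apply: elt_emin => //.
case: a => a /=; rewrite unfold_in /vint valM => va.
case: (v a) va (v (vring_val x)) vx => [g|] //= g0 [h|] //; rewrite /elt /=.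
rewrite -!oag_ltNge => h0; apply: (lt_le_trans h0).
by rewrite -[leLHS]add0r oag_leD2rE.
Qed.

HB.instance Definition _ := isIdealr.Build vring vmax vmax_idealr.

Definition residue := {ideal_quot vmax}.
HB.instance Definition _ := GRing.ComNzRing.on residue.
HB.instance Definition _ := NzRingQuotient.on residue.

Lemma residue_eqE a b : (\pi_residue a == \pi_residue b) = (a - b \in vmax).
Proof. by rewrite -Quotient.idealrBE. Qed.

Lemma residue_eq0 a : (\pi_residue a == 0) = (a \in vmax).
Proof. by rewrite -(raddf0 \pi_residue) residue_eqE subr0. Qed.

Lemma residue_neq0 (r : residue) : r != 0 -> v (vring_val (repr r)) = Some 0.
Proof.
rewrite -{1}[r]reprK residue_eq0; move: (repr r) => a.
have := valP a; rewrite !unfold_in /vmax /vint /elt /= negbK.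
by case: (v _) => //= g g0 g0'; congr Some; apply/eqP; rewrite eq_le g0 g0'.
Qed.

Definition residue_inv (r : residue) : residue :=
  if r == 0 then 0 else \pi_residue (insubd (0 : vring) (vring_val (repr r))^-1).

Fact residue_mulVf (r : residue) : r != 0 -> residue_inv r * r = 1.
Proof.
move=> r0; rewrite /residue_inv (negPf r0) -{2}[r]reprK.
rewrite -(rmorphM \pi_residue) -(rmorph1 \pi_residue); congr (\pi_residue _).
apply: val_inj => /=; have vr := residue_neq0 r0.
have vi : (vring_val (repr r))^-1 \in vint.
  by rewrite unfold_in /vint (valV vr) oppr0 ele_refl.
rewrite (insubdK _ vi) /=.
by rewrite mulVf //; apply/eqP => /(val_eq0 v); rewrite vr.
Qed.

Fact residue_invr0 : residue_inv 0 = 0.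
Proof. by rewrite /residue_inv eqxx. Qed.

HB.instance Definition _ :=
  GRing.ComNzRing_isField.Build residue residue_mulVf residue_invr0.

End ValuationRing.

Arguments vmax {K} v _.

Definition coarsening (K : fieldType) (v w : valuation K) :=
  {subset vint v <= vint w}.

Section Coarsen.
Variables (K : fieldType) (v : valuation K) (D : convexSubgroup (vgroup v)).

Definition coarsen_fun (x : K) : option (gquot D) := omap \pi_(gquot D) (v x).

Fact coarsen_eq0 x : coarsen_fun x = None <-> x = 0.
Proof. by rewrite -(val_eq0 v) /coarsen_fun; case: (v x). Qed.

Fact coarsenM x y : coarsen_fun (x * y) = eadd (coarsen_fun x) (coarsen_fun y).
Proof.
by rewrite /coarsen_fun valM; case: (v x) (v y) => [g|] [h|] //=; rewrite raddfD.
Qed.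

Lemma ele_omap_pi (a b : option (vgroup v)) :
  ele a b -> ele (omap \pi_(gquot D) a) (omap \pi_(gquot D) b).
Proof. by case: a b => [g|] [h|] //=; apply: gquot_le_pi. Qed.

Fact coarsenD x y :
  ele (emin (coarsen_fun x) (coarsen_fun y)) (coarsen_fun (x + y)).
Proof.
apply: ele_trans (ele_omap_pi (valD v x y)).
rewrite {1}/emin /coarsen_fun; case: ifP => [xy|/negbT xy].
  by rewrite /emin; case: ifP => // _; apply: ele_refl.
by rewrite /emin; case: ifP => // _; [exact: elt_le|exact: ele_refl].
Qed.

Fact coarsen_surj (g : gquot D) : exists x, coarsen_fun x = Some g.
Proof.
have [x vx] := val_surj (repr g); exists x.
by rewrite /coarsen_fun vx /= reprK.
Qed.

Definition coarsen : valuation K :=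
  Valuation coarsen_eq0 coarsenM coarsenD coarsen_surj.

Lemma vint_coarsen x :
  (x \in vint coarsen) = (x \in vint v) || oapp (mem D) true (v x).
Proof.
rewrite !unfold_in /vint /= /coarsen_fun; case: (v x) => //= g.
by rewrite -(raddf0 \pi_(gquot D)) raddf0 gquot_ge0E.
Qed.

Lemma coarsen_coarsening : coarsening v coarsen.
Proof. by move=> x vx; rewrite vint_coarsen vx. Qed.

End Coarsen.

Lemma coarsen_sub (K : fieldType) (v : valuation K)
    (D E : convexSubgroup (vgroup v)) :
  {subset D <= E} -> coarsening (coarsen D) (coarsen E).
Proof.
move=> DE x; rewrite !vint_coarsen; case: (x \in vint v) => //=.
by case: (v x) => //= g; apply: DE.
Qed.

Section Induced.
Variables (K : fieldType) (v w : valuation K).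

(* The subgroup v(O_w^x) of vK. *)
Definition in_induced (g : vgroup v) : bool :=
  `[< exists2 x : K, w x = Some 0 & v x = Some g >].

Fact in_induced_zmod : zmod_closed in_induced.
Proof.
split=> [|g h /asboolP[x wx vx] /asboolP[y wy vy]].
  by apply/asboolP; exists 1; rewrite val1.
apply/asboolP; exists (x / y); rewrite valM.
  by rewrite wx (valV wy) /= subr0.
by rewrite vx (valV vy).
Qed.

HB.instance Definition _ :=
  GRing.isZmodClosed.Build (vgroup v) in_induced in_induced_zmod.

Definition induced_subgroup : zmodClosed (vgroup v) :=
  GRing.ZmodClosed.clone (vgroup v) in_induced _.

Definition induced_group : oagType := subgroup induced_subgroup.

Hypothesis vw : coarsening v w.

(* Maps the class of x in O_w to v x unless x is in the maximal ideal. *)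
Definition induced_fun (r : residue w) : option induced_group :=
  if r == 0 then None else obind insub (v (vring_val (repr r))).

Lemma vint_unit x : v x = Some 0 -> w x = Some 0.
Proof.
move=> vx; have wx : x \in vint w by apply: vw; rewrite unfold_in /vint vx ele_refl.
have wVx : x^-1 \in vint w.
  by apply: vw; rewrite unfold_in /vint (valV vx) oppr0 ele_refl.
have x0 : x != 0 by apply/eqP => /(val_eq0 v); rewrite vx.
have [g wg] := val_neq0 w x0.
move: wx wVx; rewrite !unfold_in /vint (valV wg) wg /= oag_oppr_ge0 => g0 g0'.
by congr Some; apply/le_anti; rewrite g0 g0'.
Qed.

Lemma vmax_sub x : elt (Some 0) (w x) -> elt (Some 0) (v x).
Proof.
move=> wx; rewrite /elt; apply/negP; case E: (v x) => [g|] //= g0.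
have : x^-1 \in vint w.
  by apply: vw; rewrite unfold_in /vint (valV E) /= oag_oppr_ge0.
have [h wh] : exists h, w x = Some h.
  by apply: val_neq0; apply/eqP => /(val_eq0 v); rewrite E.
move: wx; rewrite unfold_in /vint (valV wh) wh /elt /= oag_oppr_ge0.
by move=> /negbTE ->.
Qed.

Lemma val_congr x y : w x = Some 0 -> elt (Some 0) (w (x - y)) -> v x = v y.
Proof.
move=> wx wxy; have x0 : x != 0 by apply/eqP => /(val_eq0 w); rewrite wx.
suff vu : v (y / x) = Some 0.
  have -> : y = (y / x) * x by rewrite divfK.
  by rewrite valM vu; case: (v x) => //= g; rewrite add0r.
have vd : elt (Some 0) (v (1 - y / x)).
  apply: vmax_sub; rewrite -(mulfV x0) -mulrBl valM (valV wx) oppr0.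
  by move: wxy; case: (w (x - y)) => //= g; rewrite addr0.
have v1d : ele (Some 0) (v (y / x)).
  rewrite -[y / x](subKr 1); apply: ele_trans (valD v _ _).
  by rewrite ele_emin // ?valN ?val1 ?ele_refl // elt_le.
have : ~~ elt (Some 0) (v (y / x)).
  apply/negP => vyx; have := elt_emin vyx vd.
  move=> /elt_le_trans /(_ (valD v _ _)).
  by rewrite addrC subrK val1 /elt ele_refl.
rewrite /elt negbK; case: (v (y / x)) v1d => //= g g0 g0'.
by congr Some; apply/le_anti; rewrite g0 g0'.
Qed.

Lemma induced_repr (r : residue w) (x : vring w) :
  \pi_(residue w) x = r -> r != 0 ->
  v (vring_val (repr r)) = v (vring_val x).
Proof.
move=> xr r0; apply: val_congr; first exact: residue_neq0.
have : repr r - x \in vmax w by rewrite -residue_eqE reprK xr.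
by [].
Qed.

Lemma induced_val (r : residue w) : r != 0 ->
  exists2 g : induced_group,
    induced_fun r = Some g & v (vring_val (repr r)) = Some (val g).
Proof.
move=> r0; have wr := residue_neq0 r0.
have [g vg] : exists g, v (vring_val (repr r)) = Some g.
  by apply: val_neq0; apply/eqP => /(val_eq0 w); rewrite wr.
have Hg : g \in induced_subgroup.
  by apply/asboolP; exists (vring_val (repr r)).
by exists (Sub g Hg); rewrite // /induced_fun (negPf r0) vg /= insubT.
Qed.

Fact induced_eq0 r : induced_fun r = None <-> r = 0.
Proof.
split=> [|->]; last by rewrite /induced_fun eqxx.
by have [//|/induced_val[g ->]] := eqVneq r 0.
Qed.

Fact inducedM r s : induced_fun (r * s) = eadd (induced_fun r) (induced_fun s).
Proof.
have [->|r0] := eqVneq r 0; first by rewrite mul0r /induced_fun eqxx.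
have [->|s0] := eqVneq s 0.
  by rewrite mulr0 /induced_fun eqxx; case: ifP => // _; case: obind.
have [g -> vg] := induced_val r0; have [h -> vh] := induced_val s0.
have rs0 : r * s != 0 by rewrite mulf_neq0.
have [k -> vk] := induced_val rs0; congr Some; apply: val_inj => /=.
apply: Some_inj; rewrite -vk (@induced_repr _ (repr r * repr s)) //=.
  by rewrite valM vg vh.
by rewrite (rmorphM \pi_(residue w)) /= !reprK.
Qed.

Fact inducedD r s :
  ele (emin (induced_fun r) (induced_fun s)) (induced_fun (r + s)).
Proof.
have eminN (G : oagType) (a : option G) : emin None a = a by case: a.
have [->|r0] := eqVneq r 0.
  by rewrite add0r {1}/induced_fun eqxx eminN ele_refl.
have [->|s0] := eqVneq s 0.
  rewrite addr0 {2}/induced_fun eqxx /emin; case: ifP => //; first by rewrite ele_refl.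
  by case: induced_fun.
have [->|rs0] := eqVneq (r + s) 0.
  by rewrite {3}/induced_fun eqxx; case: emin.
have [g -> vg] := induced_val r0; have [h -> vh] := induced_val s0.
have [k -> vk] := induced_val rs0.
have e : v (vring_val (repr (r + s))) =
         v (vring_val (repr r) + vring_val (repr s)).
  apply: (@induced_repr _ (repr r + repr s)) => //.
  by rewrite (raddfD \pi_(residue w)) /= !reprK.
have := valD v (vring_val (repr r)) (vring_val (repr s)).
by rewrite -e vg vh vk /emin /= -!leEsub; case: ifP.
Qed.

Fact induced_surj (g : induced_group) : exists r, induced_fun r = Some g.
Proof.
have /asboolP[x wx vx] := valP g.
have Hx : x \in vint w by rewrite unfold_in /vint wx ele_refl.
have r0 : \pi_(residue w) (VRing Hx) != 0.
  by rewrite residue_eq0 unfold_in /vmax /= wx /elt ele_refl.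
exists (\pi_(residue w) (VRing Hx)); have [h -> vh] := induced_val r0.
congr Some; apply: val_inj; apply: Some_inj.
by rewrite -vx -vh; apply: (@induced_repr _ (VRing Hx)).
Qed.

Definition induced : valuation (residue w) :=
  Valuation induced_eq0 inducedM inducedD induced_surj.

End Induced.

Definition mixed_char (p : nat) (K : fieldType) (v : valuation K) :=
  [pchar K] =i pred0 /\ p \in [pchar (residue v)].

Definition perfect (F : fieldType) :=
  forall (q : nat) (chFq : q \in [pchar F]),
    forall y : F, exists x : F, pFrobenius_aut chFq x = y.

Definition semiperfect (p : nat) (R : comNzRingType) :=
  exists chRp : p \in [pchar R],
    forall y : R, exists x : R, pFrobenius_aut chRp x = y.

Section MixedCharacteristic.
Variables (p : nat) (K : fieldType) (v : valuation K).

(* v(p) as an element of vK; the default value is only used if p = 0 in K. *)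
Definition pval : vgroup v := odflt 0 (v p%:R).

Definition coarse0 : valuation K := coarsen (cvx_hull pval).
Definition coarsep : valuation K := coarsen (max_cvx pval).

Lemma coarsening0 : coarsening v coarse0.
Proof. exact: coarsen_coarsening. Qed.

Lemma coarseningp : coarsening v coarsep.
Proof. exact: coarsen_coarsening. Qed.

Lemma coarseningp0 : coarsening coarsep coarse0.
Proof. exact/coarsen_sub/max_cvx_hull. Qed.

(* [coarse0] is the finest coarsening w of v with w(p) = 0. *)
Lemma coarse0_finest : p%:R != 0 :> K ->
  coarse0 p%:R = Some 0 /\
  forall w : valuation K, coarsening v w -> w p%:R = Some 0 ->
    coarsening coarse0 w.
Proof.
move=> p0; have [g vg] := val_neq0 v p0; have pg : pval = g by rewrite /pval vg.
split.
  rewrite /= /coarsen_fun vg /= -[in RHS](raddf0 \pi_(gquot (cvx_hull pval))).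
  by congr Some; apply/eqP; rewrite gquot_eqE subr0 pg cvx_hull_id.
move=> w vw wp x; rewrite vint_coarsen => /orP[/vw//|].
case E: (v x) => [h|] /=; last by move/val_eq0: E => -> _; rewrite rpred0.
move=> /asboolP[a [b /andP[ah _]]].
have -> : x = x * p%:R ^ (- a) * p%:R ^ a.
  by rewrite -mulrA -expfzDr // addNr expr0z mulr1.
apply: rpredM.
  apply: vw; rewrite unfold_in /vint valM E (valXz _ vg) /= mulrNz -pg.
  by rewrite oag_subr_ge0.
by rewrite unfold_in /vint (valXz _ wp) mul0rz ele_refl.
Qed.

(* [coarsep] is the coarsest coarsening w of v with w(p) > 0. *)
Lemma coarsep_coarsest : p%:R != 0 :> K -> elt (Some 0) (v p%:R) ->
  elt (Some 0) (coarsep p%:R) /\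
  forall w : valuation K, coarsening v w -> elt (Some 0) (w p%:R) ->
    coarsening w coarsep.
Proof.
move=> p0; have [g vg] := val_neq0 v p0; have pg : pval = g by rewrite /pval vg.
rewrite vg /elt /= -oag_ltNge => g0.
have pi0 : \pi_(gquot (max_cvx pval)) 0 = 0 by apply: raddf0.
split.
  rewrite /= /coarsen_fun vg /= -oag_ltNge lt_neqAle -{2}pi0 gquot_le_pi ?ltW //.
  rewrite andbT eq_sym -pi0 gquot_eqE subr0 -pg max_cvx_notin // pg.
  by rewrite gt_eqF.
move=> w vw wp x wx; rewrite vint_coarsen; apply/orP.
case E: (v x) => [h|] /=; last by right.
have [h0|h0] := oag_leVge 0 h; first by left; rewrite unfold_in /vint E.
right; have [//|Dh] := boolP (h \in max_cvx pval).
have /asboolP[a [b /andP[_ gb]]] : pval \in cvx_hull h.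
  have [//|gN] := boolP (pval \in cvx_hull h).
  by rewrite (max_cvx_max gN (cvx_hull_id h)) in Dh.
have x0 : x != 0 by apply/eqP => /(val_eq0 v); rewrite E.
have wVx : x^-1 \in vint w.
  by apply: vw; rewrite unfold_in /vint (valV E) /= oag_oppr_ge0 ltW.
have [k wk] := val_neq0 w x0.
have k0 : k = 0.
  move: wx wVx; rewrite !unfold_in /vint (valV wk) wk /= oag_oppr_ge0.
  by move=> k0 k0'; apply/le_anti; rewrite k0 k0'.
have : x ^ b / p%:R \in vint w.
  apply: vw; rewrite unfold_in /vint valM (valXz _ E) (valV vg) /= -pg.
  by rewrite oag_subr_ge0.
have [l wl] := val_neq0 w p0.
rewrite unfold_in /vint valM (valXz _ wk) k0 mul0rz (valV wl) /= add0r.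
by rewrite oag_oppr_ge0; move: wp; rewrite wl /= => /negbTE ->.
Qed.

(* The ideal p O_v, which is proper in mixed characteristic. *)
Definition pideal of mixed_char p v : {pred vring v} :=
  fun a => `[< exists b : vring v, a = p%:R * b >].

Variable hp : mixed_char p v.

Fact pideal_idealr : idealr_closed (pideal hp).
Proof.
split.
- by apply/asboolP; exists 0; rewrite mulr0.
- apply/negP => /asboolP[b /(congr1 \pi_(residue v))].
  have /= := pcharf0 hp.2.
  rewrite (rmorphM \pi_(residue v)) (rmorph1 \pi_(residue v)) /=.
  rewrite (rmorph_nat \pi_(residue v)) => ->; rewrite mul0r => /eqP.
  by rewrite oner_eq0.
move=> a x y /asboolP[b ->] /asboolP[c ->]; apply/asboolP.
by exists (a * b + c); rewrite mulrDr mulrCA.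
Qed.

HB.instance Definition _ := isIdealr.Build (vring v) (pideal hp) pideal_idealr.

Definition vring_modp : comNzRingType := {ideal_quot pideal hp}.

End MixedCharacteristic.

(* The language of rings with a unary predicate for the valuation ring, with
   additional constants from [C]; the formulas of type [formula C n] have their
   free variables among 'I_n, and [Ex] binds the variable [ord0]. *)
Section Formulas.
Variable C : Type.

Inductive term (n : nat) : Type :=
| Var of 'I_n
| Cst of C
| Zero
| One
| Add of term n & term n
| Opp of term n
| Mul of term n & term n.

Inductive formula : nat -> Type :=
| Eq n of term n & term n : formula n
| Int n of term n : formula n
| Not n of formula n : formula n
| And n of formula n & formula n : formula n
| Ex n of formula n.+1 : formula n.

Variables (K : fieldType) (v : valuation K) (c : C -> K).

Fixpoint eval n (e : 'I_n -> K) (t : term n) : K :=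
  match t with
  | Var i => e i
  | Cst a => c a
  | Zero => 0
  | One => 1
  | Add t u => eval e t + eval e u
  | Opp t => - eval e t
  | Mul t u => eval e t * eval e u
  end.

Definition push n (x : K) (e : 'I_n -> K) : 'I_n.+1 -> K :=
  fun i => if unlift ord0 i is Some j then e j else x.

Fixpoint holds n (phi : formula n) : ('I_n -> K) -> Prop :=
  match phi with
  | Eq _ t u => fun e => eval e t = eval e u
  | Int _ t => fun e => eval e t \in vint v
  | Not _ phi => fun e => ~ holds phi e
  | And _ phi psi => fun e => holds phi e /\ holds psi e
  | Ex _ phi => fun e => exists x, holds phi (push x e)
  end.

End Formulas.

Definition elementary (K L : fieldType) (v : valuation K) (w : valuation L)
    (f : K -> L) :=
  forall n (phi : formula void n) (e : 'I_n -> K),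
    holds v (of_void K) phi e <-> holds w (of_void L) phi (f \o e).

Definition aleph1_saturated (K : fieldType) (v : valuation K) :=
  forall A : set K, countable A ->
  forall Phi : set (formula {a : K | A a} 1),
    (forall Psi : set (formula {a : K | A a} 1),
       (Psi `<=` Phi)%classic -> finite_set Psi ->
       exists x : K, forall phi, Psi phi -> holds v sval phi (fun=> x)) ->
    exists x : K, forall phi, Phi phi -> holds v sval phi (fun=> x).

(* Main.v *)
(* (i) is expressible by first-order sentences, so it passes to and from
   elementary extensions. If (i) holds, a p-th root modulo p of an element of
   value g in [0, v(p)) has value g/p, and v(p) is itself a sum of two such
   values; hence the convex hull of v(p) is p-divisible, while p-th roots modulo
   p give p-th roots in the residue field of v_p, where p vanishes. For (iii), a
   nonprincipal ultrapower over nat is aleph_1-saturated, and a quotient of a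
   p-divisible group is p-divisible. Conversely, if K v_p is perfect and the
   value group of v_p on K v_0 is p-divisible, then whenever v(x^p - y) < v(p)
   some x + d has v_p((x + d)^p - y) > v_p(x^p - y): take d^p close to y - x^p.
   The value group of v_p on K v_0 being archimedean, countably many
   approximations are cofinal among all of them, so aleph_1-saturation produces
   an x that cannot be improved: it satisfies x^p = y modulo p. *)
From HB Require Import structures.
From mathcomp Require Import all_boot all_order all_algebra.
From mathcomp Require Import ring_quotient generic_quotient.
From mathcomp Require Import boolp classical_sets functions cardinality filter.
Require Import Defs.

Set Implicit Arguments.
Unset Strict Implicit.
Unset Printing Implicit Defensive.

Import Order.TTheory GRing.Theory.
Local Open Scope quotient_scope.
Local Open Scope classical_set_scope.
Local Open Scope ring_scope.

(** * Ultrapowers *)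

Lemma ultra_near_not (I : Type) (U : set_system I) (P : I -> Prop) :
  UltraFilter U -> ~ (\forall i \near U, P i) -> \forall i \near U, ~ P i.
Proof. by move=> FU NP; have [] := in_ultra_setVsetC [set i | P i] FU. Qed.

Lemma near_not (I : Type) (U : set_system I) (P : I -> Prop) :
  ProperFilter U -> (\forall i \near U, ~ P i) -> ~ (\forall i \near U, P i).
Proof. by move=> FU nP P1; have [i []] := filter_ex (filterI nP P1). Qed.

Section UltrapowerGroup.
Variables (I : Type) (U : set_system I) (FU : UltraFilter U) (G : oagType).
#[local] Existing Instance FU.

(* The ultrafilter hypothesis is a parameter so that the closure properties can
   be attached to the predicate as canonical instances. *)
Definition near0G of UltraFilter U : {pred I -> G} :=
  fun a => `[< \forall i \near U, a i = 0 >].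

Fact near0G_zmod : zmod_closed (near0G FU).
Proof.
split=> [|a b /asboolP a0 /asboolP b0]; apply/asboolP; first exact: nearW.
by apply: filterS2 a0 b0 => i ai bi; change (a i - b i = 0); rewrite ai bi subr0.
Qed.

HB.instance Definition _ := GRing.isZmodClosed.Build (I -> G) (near0G FU)
  near0G_zmod.

Definition upowG := Quotient.quot (GRing.ZmodClosed.clone (I -> G) (near0G FU) _).
HB.instance Definition _ := ZmodQuotient.on upowG.

Lemma upowG_eqP (a b : I -> G) :
  reflect (\forall i \near U, a i = b i) (\pi_upowG a == \pi_upowG b).
Proof.
rewrite -Quotient.idealrBE unfold_in; apply: (iffP (asboolP _)); apply: filterS => i.
  by move/eqP; rewrite [_ == 0]subr_eq0 => /eqP.
by move=> ab; change (a i - b i = 0); rewrite ab subrr.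
Qed.

(** The order is read off canonical representatives; [upowG_leE] frees it from that choice. *)
Definition upowG_le (a b : upowG) := `[< \forall i \near U, repr a i <= repr b i >].

Lemma repr_upowG (a : I -> G) : \forall i \near U, repr (\pi_upowG a) i = a i.
Proof. by apply/upowG_eqP; rewrite reprK. Qed.

Lemma upowG_leE (a b : I -> G) :
  upowG_le (\pi_upowG a) (\pi_upowG b) <-> \forall i \near U, a i <= b i.
Proof.
have [ra rb] := (repr_upowG a, repr_upowG b).
by split=> [/asboolP|] h; [|apply/asboolP]; apply: filterS3 ra rb h => i -> ->.
Qed.

Fact upowG_le_refl : reflexive upowG_le.
Proof. by move=> a; apply/asboolP/nearW. Qed.

Fact upowG_le_anti : antisymmetric upowG_le.
Proof.
move=> a b /andP[/asboolP ab /asboolP ba]; rewrite -[a]reprK -[b]reprK.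
apply/eqP/upowG_eqP; apply: filterS2 ab ba => i ab ba.
by apply/le_anti; rewrite ab.
Qed.

Fact upowG_le_trans : transitive upowG_le.
Proof.
move=> b a c /asboolP ab /asboolP bc; apply/asboolP.
by apply: filterS2 ab bc => i; apply: le_trans.
Qed.

Fact upowG_le_total : total upowG_le.
Proof.
move=> a b; apply/orP; have [|/ultra_near_not ab] :=
  pselect (\forall i \near U, repr a i <= repr b i); [by left; apply/asboolP|right].
apply/asboolP; apply: filterS ab => i.
by case/orP: (oag_le_total (repr a i) (repr b i)).
Qed.

HB.instance Definition _ := Order.Le_isPOrder.Build ring_display upowG
  upowG_le_refl upowG_le_anti upowG_le_trans.

Fact upowG_leD2l (c a b : upowG) : a <= b -> c + a <= c + b.
Proof.
move=> /asboolP ab; rewrite -[a]reprK -[b]reprK -[c]reprK -!raddfD.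
by apply/upowG_leE; apply: filterS ab => i ab; rewrite oag_leD2l.
Qed.

HB.instance Definition _ := POrderedZmodule_isOrderedGroup.Build upowG
  upowG_le_total upowG_leD2l.

(** An ultrafilter decides whether the values are oo almost everywhere or finite almost everywhere.
    In the finite case the default 0 is read only on a negligible set of indices. *)
Definition uopt (a : I -> option G) : option upowG :=
  if `[< \forall i \near U, a i = None >] then None
  else Some (\pi_upowG (fun i => odflt 0 (a i))).

Lemma near_option (a : I -> option G) :
  (\forall i \near U, a i = None) \/
  (\forall i \near U, a i = Some (odflt 0 (a i))).
Proof.
have [|/ultra_near_not h] := pselect (\forall i \near U, a i = None); first by left.
by right; apply: filterS h => i; case: (a i).
Qed.

Lemma uopt_none (a : I -> option G) :
  (\forall i \near U, a i = None) -> uopt a = None.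
Proof. by move=> a0; rewrite /uopt asboolT. Qed.

Lemma uopt_some (a : I -> option G) (g : I -> G) :
  (\forall i \near U, a i = Some (g i)) -> uopt a = Some (\pi_upowG g).
Proof.
move=> ag; rewrite /uopt asboolF.
  by congr Some; apply/eqP/upowG_eqP; apply: filterS ag => i ->.
apply: near_not.
by apply: filterS ag => i ->.
Qed.

Lemma uopt_eadd (a b : I -> option G) :
  uopt (fun i => eadd (a i) (b i)) = eadd (uopt a) (uopt b).
Proof.
have [a0|aS] := near_option a.
  by rewrite (uopt_none a0) uopt_none //; apply: filterS a0 => i ->.
have [b0|bS] := near_option b.
  rewrite uopt_none ?(uopt_none b0); first by case: (uopt a).
  by apply: filterS b0 => i ->; case: (a i).
rewrite (uopt_some aS) (uopt_some bS) -[RHS]/(Some (_ + _)) -raddfD.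
by apply: uopt_some; apply: filterS2 aS bS => i -> ->.
Qed.

Lemma uopt_ele (a b : I -> option G) :
  ele (uopt a) (uopt b) <-> \forall i \near U, ele (a i) (b i).
Proof.
have [b0|bS] := near_option b.
  rewrite (uopt_none b0); split=> [_|_]; last by case: uopt.
  by apply: filterS b0 => i ->; case: (a i).
have [a0|aS] := near_option a.
  rewrite (uopt_none a0) (uopt_some bS); split=> // h.
  by have [i [[]]] := filter_ex (filterI (filterI a0 bS) h) => -> ->.
rewrite (uopt_some aS) (uopt_some bS); apply: (iff_trans (upowG_leE _ _)).
by split=> h; apply: filterS3 aS bS h => i -> ->.
Qed.

Lemma uopt_emin (a b c : I -> option G) :
  (\forall i \near U, ele (emin (a i) (b i)) (c i)) ->
  ele (emin (uopt a) (uopt b)) (uopt c).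
Proof.
move=> h; rewrite {1}/emin; case: ifP => [/uopt_ele ab|/negP nab].
  by apply/uopt_ele; apply: filterS2 ab h => i; rewrite /emin => ->.
have /ultra_near_not ba : ~ \forall i \near U, ele (a i) (b i).
  by move=> /uopt_ele.
by apply/uopt_ele; apply: filterS2 ba h => i; rewrite /emin => /negP/negbTE ->.
Qed.

End UltrapowerGroup.

Arguments uopt_none {I U FU G a}.
Arguments uopt_some {I U FU G a g}.

(** * Ultrapowers of valued fields and the theorem of Łoś *)

Section UltrapowerField.
Variables (I : pointedType) (U : set_system I) (FU : UltraFilter U) (K : fieldType).
#[local] Existing Instance FU.

Definition near0K of UltraFilter U : {pred I -> K} :=
  fun a => `[< \forall i \near U, a i = 0 >].

Fact near0K_idealr : idealr_closed (near0K FU).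
Proof.
split=> [||a x y /asboolP x0 /asboolP y0]; first by apply/asboolP/nearW.
  apply/negP => /asboolP/filter_ex[i] /eqP.
  by rewrite [_ == _]oner_eq0.
apply/asboolP; apply: filterS2 x0 y0 => i xi yi.
by change (a i * x i + y i = 0); rewrite xi yi mulr0 addr0.
Qed.

HB.instance Definition _ := isIdealr.Build (I -> K) (near0K FU) near0K_idealr.

Definition upow := {ideal_quot (near0K FU)}.
HB.instance Definition _ := GRing.ComNzRing.on upow.
HB.instance Definition _ := NzRingQuotient.on upow.

Lemma upow_eqP (a b : I -> K) :
  reflect (\forall i \near U, a i = b i) (\pi_upow a == \pi_upow b).
Proof.
rewrite -Quotient.idealrBE unfold_in; apply: (iffP (asboolP _)); apply: filterS => i.
  by move/eqP; rewrite [_ == 0]subr_eq0 => /eqP.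
by move=> ab; change (a i - b i = 0); rewrite ab subrr.
Qed.

Lemma repr_upow (a : I -> K) : \forall i \near U, repr (\pi_upow a) i = a i.
Proof. by apply/upow_eqP; rewrite reprK. Qed.

Lemma pi_upow0 (a : I -> K) : \pi_upow a = 0 <-> \forall i \near U, a i = 0.
Proof.
by rewrite -(raddf0 \pi_upow); split=> [/eqP/upow_eqP|h] //; apply/eqP/upow_eqP.
Qed.

Definition upow_inv (r : upow) : upow := \pi_upow (fun i => (repr r i)^-1).

Fact upow_mulVf (r : upow) : r != 0 -> upow_inv r * r = 1.
Proof.
move=> /eqP r0; rewrite /upow_inv -{2}[r]reprK.
rewrite -(rmorphM \pi_upow) -(rmorph1 \pi_upow); apply/eqP/upow_eqP.
have /ultra_near_not : ~ \forall i \near U, repr r i = 0.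
  by move=> /pi_upow0; rewrite reprK.
by apply: filterS => i /eqP ri; apply: mulVf.
Qed.

Fact upow_invr0 : upow_inv 0 = 0.
Proof.
apply/pi_upow0; have /pi_upow0 : \pi_upow (repr (0 : upow)) = 0 by rewrite reprK.
by apply: filterS => i ->; rewrite invr0.
Qed.

HB.instance Definition _ :=
  GRing.ComNzRing_isField.Build upow upow_mulVf upow_invr0.

Variable v : valuation K.

Definition upow_val_fun (r : upow) : option (upowG FU (vgroup v)) :=
  uopt FU (fun i => v (repr r i)).

Lemma upow_val_pi (a : I -> K) : upow_val_fun (\pi_upow a) = uopt FU (v \o a).
Proof.
have ra := repr_upow a; have [a0|aS] := near_option FU (v \o a).
  rewrite /upow_val_fun (uopt_none a0); apply: uopt_none.
  by apply: filterS2 ra a0 => i ->.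
rewrite /upow_val_fun (uopt_some aS); apply: uopt_some.
by apply: filterS2 ra aS => i ->.
Qed.

Fact upow_val_eq0 r : upow_val_fun r = None <-> r = 0.
Proof.
have := pi_upow0 (repr r); rewrite reprK => ->; split=> [|h].
  rewrite /upow_val_fun; have [a0 _|aS] := near_option FU (fun i => v (repr r i)).
    by apply: filterS a0 => i /val_eq0.
  by rewrite (uopt_some aS).
by apply: uopt_none; apply: filterS h => i ->; rewrite val0.
Qed.

Fact upow_valM r s :
  upow_val_fun (r * s) = eadd (upow_val_fun r) (upow_val_fun s).
Proof.
rewrite -[r in LHS]reprK -[s in LHS]reprK -(rmorphM \pi_upow) upow_val_pi.
rewrite -uopt_eadd; congr uopt; apply/funext => i.
exact: (valM v (repr r i) (repr s i)).
Qed.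

Fact upow_valD r s :
  ele (emin (upow_val_fun r) (upow_val_fun s)) (upow_val_fun (r + s)).
Proof.
rewrite -[r in X in ele _ X]reprK -[s in X in ele _ X]reprK -(raddfD \pi_upow).
rewrite upow_val_pi; apply: uopt_emin; apply: nearW => i.
exact: (valD v (repr r i) (repr s i)).
Qed.

Fact upow_val_surj (g : upowG FU (vgroup v)) : exists r, upow_val_fun r = Some g.
Proof.
have /choice[x xE] (i : I) : exists x, v x = Some (repr g i) by apply: val_surj.
exists (\pi_upow x); rewrite upow_val_pi -[g]reprK.
by apply: uopt_some; apply: nearW.
Qed.

Definition upow_val : valuation upow :=
  Valuation upow_val_eq0 upow_valM upow_valD upow_val_surj.

Lemma vint_upow (a : I -> K) :
  \pi_upow a \in vint upow_val <-> \forall i \near U, a i \in vint v.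
Proof.
rewrite unfold_in /vint -[upow_val _]/(upow_val_fun _) upow_val_pi.
have <- : uopt FU (fun=> Some 0) = Some (0 : upowG FU (vgroup v)).
  rewrite (@uopt_some _ _ FU _ _ (fun=> 0)); last by apply: nearW.
  by congr Some; apply: raddf0.
exact: uopt_ele.
Qed.

Lemma eval_upow (C : Type) (c : C -> I -> K) n (t : term C n) (e : 'I_n -> I -> K) :
  eval (fun a => \pi_upow (c a)) (fun j => \pi_upow (e j)) t =
  \pi_upow (fun i => eval (c^~ i) (e^~ i) t).
Proof.
elim: t => //= [||t -> u ->|t ->|t -> u ->].
- by rewrite -(raddf0 \pi_upow).
- by rewrite -(rmorph1 \pi_upow).
- by rewrite -(raddfD \pi_upow).
- by rewrite -(raddfN \pi_upow).
- by rewrite -(rmorphM \pi_upow).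
Qed.

(** Łoś's theorem. Negation uses that the ultrafilter decides every set of indices, and the
    existential quantifier uses witnesses chosen coordinatewise. *)
Lemma los (C : Type) (c : C -> I -> K) n (phi : formula C n) (e : 'I_n -> I -> K) :
  holds upow_val (fun a => \pi_upow (c a)) phi (fun j => \pi_upow (e j)) <->
  \forall i \near U, holds v (c^~ i) phi (e^~ i).
Proof.
elim: phi e => {n}[n t u|n t|n phi IH|n phi IH psi IH'|n phi IH] e /=.
- rewrite !eval_upow; split=> [/eqP/upow_eqP//|h].
  exact/eqP/upow_eqP.
- by rewrite eval_upow; apply: vint_upow.
- split=> [h|/near_not h].
    by apply: ultra_near_not => /IH.
  by move=> /IH.
- split=> [[/IH h /IH' h']|h]; first exact: filterI.
  by split; [apply/IH|apply/IH']; apply: filterS h => i [].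
pose ext (x : I -> K) (j : 'I_n.+1) := if unlift ord0 j is Some k then e k else x.
have pushE (x : I -> K) :
    push (\pi_upow x) (fun j => \pi_upow (e j)) = fun j => \pi_upow (ext x j).
  by apply/funext => j; rewrite /push /ext; case: unlift.
have pushE' x i : push (x i) (e^~ i) = (ext x)^~ i.
  by apply/funext => j; rewrite /push /ext; case: unlift.
split=> [[r]|h].
  rewrite -[r]reprK pushE => /IH; apply: filterS => i hi.
  by exists (repr r i); rewrite pushE'.
(* The implication makes the choice total: 0 is taken where there is no witness, which happens only
   on a negligible set. *)
have /choice[x xE] (i : I) : exists x,
    (exists y, holds v (c^~ i) phi (push y (e^~ i))) ->
    holds v (c^~ i) phi (push x (e^~ i)).
  have [[y hy]|hn] := pselect (exists y, holds v (c^~ i) phi (push y (e^~ i))).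
    by exists y.
  by exists 0 => /hn.
exists (\pi_upow x); rewrite pushE; apply/IH.
by apply: filterS h => i /xE; rewrite pushE'.
Qed.

Lemma elementary_upow : elementary v upow_val (fun x => \pi_upow (fun=> x)).
Proof.
move=> n phi e; have -> : of_void upow = fun a => \pi_upow (of_void (I -> K) a).
  by apply/funext => -[].
rewrite (los (of_void _) phi (fun j _ => e j)).
have E i : (of_void (I -> K))^~ i = of_void K by apply/funext => -[].
split=> [h|/filter_ex[i]]; last by rewrite E.
by apply: nearW => i; rewrite E.
Qed.

End UltrapowerField.

(** * Saturation of ultrapowers *)

Section FormulaEncoding.
Variables (C : Type) (enc : C -> nat) (dec : nat -> option C).
Hypothesis encK : pcancel enc dec.

(** Countability of terms and formulas comes from embedding them into trees with natural numbers at
    the leaves. As [C] is a bare type, [enc] and [dec] take care of its constants. *)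
Fixpoint term_code n (t : term C n) : GenTree.tree nat :=
  match t with
  | Var i => GenTree.Node 0 [:: GenTree.Leaf (i : nat)]
  | Cst a => GenTree.Node 1 [:: GenTree.Leaf (enc a)]
  | Zero => GenTree.Node 2 [::]
  | One => GenTree.Node 3 [::]
  | Add t u => GenTree.Node 4 [:: term_code t; term_code u]
  | Opp t => GenTree.Node 5 [:: term_code t]
  | Mul t u => GenTree.Node 6 [:: term_code t; term_code u]
  end.

Fixpoint term_decode n (t : GenTree.tree nat) : option (term C n) :=
  match t with
  | GenTree.Node 0 [:: GenTree.Leaf i] => omap (@Var C n) (insub i)
  | GenTree.Node 1 [:: GenTree.Leaf a] => omap (@Cst C n) (dec a)
  | GenTree.Node 2 _ => Some (Zero C n)
  | GenTree.Node 3 _ => Some (One C n)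
  | GenTree.Node 4 [:: t; u] =>
      obind (fun t' => omap (Add t') (term_decode n u)) (term_decode n t)
  | GenTree.Node 5 [:: t] => omap (@Opp C n) (term_decode n t)
  | GenTree.Node 6 [:: t; u] =>
      obind (fun t' => omap (Mul t') (term_decode n u)) (term_decode n t)
  | _ => None
  end.

Lemma term_codeK n : pcancel (@term_code n) (@term_decode n).
Proof.
elim=> //= [i|a|t -> u -> //|t -> //|t -> u -> //]; last by rewrite encK.
by rewrite valK.
Qed.

Fixpoint formula_code n (phi : formula C n) : GenTree.tree nat :=
  match phi with
  | Eq _ t u => GenTree.Node 0 [:: term_code t; term_code u]
  | Int _ t => GenTree.Node 1 [:: term_code t]
  | Not _ phi => GenTree.Node 2 [:: formula_code phi]
  | And _ phi psi => GenTree.Node 3 [:: formula_code phi; formula_code psi]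
  | Ex _ phi => GenTree.Node 4 [:: formula_code phi]
  end.

Fixpoint formula_decode n (t : GenTree.tree nat) : option (formula C n) :=
  match t with
  | GenTree.Node 0 [:: t; u] =>
      obind (fun t' => omap (Eq t') (term_decode n u)) (term_decode n t)
  | GenTree.Node 1 [:: t] => omap (@Int C n) (term_decode n t)
  | GenTree.Node 2 [:: t] => omap (@Not C n) (formula_decode n t)
  | GenTree.Node 3 [:: t; u] =>
      obind (fun t' => omap (And t') (formula_decode n u)) (formula_decode n t)
  | GenTree.Node 4 [:: t] => omap (@Ex C n) (formula_decode n.+1 t)
  | _ => None
  end.

Lemma formula_codeK n : pcancel (@formula_code n) (@formula_decode n).
Proof.
elim=> {}n /= => [t u|t|phi -> //|phi -> psi -> //|phi -> //].
  by rewrite !term_codeK.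
by rewrite term_codeK.
Qed.

End FormulaEncoding.

Lemma countable_formula (C : Type) n :
  countable [set: C] -> countable [set: formula C n].
Proof.
move=> /countable_injP[enc enc_inj].
pose dec m : option C := if pselect (exists a, enc a = m) is left h
  then Some (sval (cid h)) else None.
have encK : pcancel enc dec.
  move=> a; rewrite /dec; case: pselect => [h|[]]; last by exists a.
  by congr Some; apply: enc_inj; rewrite ?in_setT // (svalP (cid h)).
have fK := formula_codeK encK (n := n).
apply/countable_injP; exists (pickle \o @formula_code _ enc n).
by move=> phi psi _ _ /(pcan_inj pickleK)/(pcan_inj fK).
Qed.

(* For a countable set of formulas, realize at the index i as long an initial
   segment of the enumeration, of length at most i, as can be realized there. *)
Lemma aleph1_saturated_upow (U : set_system nat) (FU : UltraFilter U)
    (K : fieldType) (v : valuation K) :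
  \oo `<=` U -> aleph1_saturated (upow_val FU v).
Proof.
move=> oU A Acount Phi fin; have PU : ProperFilter U by exact: ultra_proper.
have /countable_injP[code code_inj] : countable [set: formula {a | A a} 1].
  apply: countable_formula; move: Acount => /countable_injP[h h_inj].
  apply/countable_injP; exists (h \o sval) => -[a Aa] [b Ab] _ _ /= hab.
  by apply: eq_exist; apply: h_inj; rewrite ?inE.
have codeI phi psi : code phi = code psi -> phi = psi.
  by apply: code_inj; rewrite in_setT.
(* As [code] is injective, [Psi m] has at most m members. *)
pose Psi m := [set phi | Phi phi /\ (code phi < m)%N].
have Psi_fin m : finite_set (Psi m).
  apply: (@sub_finite_set _ _ [set phi | (code phi < m)%N]) => [phi []//|].
  have := @finite_preimage _ _ `I_m code; apply; last exact: finite_II.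
  by move=> phi psi _ _ /codeI.
pose c (a : {a | A a}) := repr (sval a).
have cE : (fun a => \pi_(upow FU K) (c a)) = sval by apply/funext => a; apply: reprK.
pose sat m i x := forall phi, Psi m phi -> holds v (c^~ i) phi (fun=> x).
have satW m m' i x : (m' <= m)%N -> sat m i x -> sat m' i x.
  by move=> lem s phi [Pphi ltm]; apply: s; split=> //; apply: leq_trans lem.
have near_sat m : \forall i \near U, exists x, sat m i x.
  have [phi []//|x xP] := fin (Psi m) _ (Psi_fin m).
  have near_all : \forall i \near U, forall phi, Psi m phi ->
      holds v (c^~ i) phi (fun=> repr x i).
    (* Each formula holds on its own large set; indexing by the codes below m leaves a finite
       intersection of large sets. *)
    have near_j (j : 'I_m) : \forall i \near U, forall phi, Phi phi ->
        code phi = j -> holds v (c^~ i) phi (fun=> repr x i).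
      have [[phi [Pphi cphi]]|nphi] := pselect (exists phi, Phi phi /\ code phi = j).
        have /(los FU v c phi (fun=> repr x)) : holds (upow_val FU v)
            (fun a => \pi_(upow FU K) (c a)) phi (fun=> \pi_(upow FU K) (repr x)).
          by rewrite cE reprK; apply: xP; split; rewrite // cphi.
        by apply: filterS => i h psi _; rewrite -cphi => /codeI ->.
      by apply: nearW => i phi Pphi cphi; case: nphi; exists phi.
    have near_js := filter_forall _ near_j.
    apply: filterS (near_js _) => i h phi [Pphi lt_phi].
    exact: (h (Ordinal lt_phi)).
  by apply: filterS near_all => i h; exists (repr x i).
(* The sets [Psi m] increase with m, so a point realizing the longest realizable one among m <= k
   realizes all the shorter ones. *)
have init_sat i k : exists x, forall m, (m <= k)%N ->
    (exists y, sat m i y) -> sat m i x.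
  elim: k => [|k [x xP]].
    by exists 0 => -[] // _ _ phi [].
  have [[y yP]|nsat] := pselect (exists y, sat k.+1 i y).
    by exists y => m lem _; apply: satW yP.
  exists x => m; rewrite leq_eqVlt ltnS => /predU1P[-> //|]; exact: xP.
have /choice[x xP] i := init_sat i i.
exists (\pi_(upow FU K) x) => phi Pphi; rewrite -cE.
rewrite (los FU v c phi (fun=> x)).
(* Cofinite sets are large, so almost every i is beyond the code of [phi], and the bound i in the
   choice of [x i] does not cut [phi] off. *)
have lt_i : \forall i \near U, (code phi < i)%N by apply: oU; exists (code phi).+1.
apply: filterS2 (near_sat (code phi).+1) lt_i => i ex_i lt_i.
by apply: (xP i (code phi).+1).
Qed.

(** * First-order sentences *)

Lemma push0 (K : fieldType) n (x : K) (e : 'I_n -> K) : push x e ord0 = x.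
Proof. by rewrite /push unlift_none. Qed.

Lemma pushS (K : fieldType) n (x : K) (e : 'I_n -> K) j :
  push x e (lift ord0 j) = e j.
Proof. by rewrite /push liftK. Qed.

Section Terms.
Variables (C : Type) (n : nat).

Definition nat_term k : term C n := iter k (Add (One C n)) (Zero C n).

Definition pow_term (t : term C n) k : term C n := iter k (Mul t) (One C n).

Definition all_formula (phi : formula C n.+1) : formula C n := Not (Ex (Not phi)).

Variables (K : fieldType) (v : valuation K) (c : C -> K) (e : 'I_n -> K).

Lemma eval_nat k : eval c e (nat_term k) = k%:R.
Proof. by elim: k => //= k ->; rewrite -natr1 addrC. Qed.

Lemma eval_pow t k : eval c e (pow_term t k) = eval c e t ^+ k.
Proof. by elim: k => //= k ->; rewrite exprS. Qed.

Lemma holds_all phi : holds v c (all_formula phi) e <->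
  forall x, holds v c phi (push x e).
Proof.
split=> /= [h x|h [x]]; last exact.
by apply: contrapT => nh; apply: h; exists x.
Qed.

End Terms.

Section Sentences.
Variables (p : nat) (K : fieldType) (v : valuation K).

(** With q = 1/p this says that p is nonzero and v(p) > 0, in terms of the valuation ring alone. *)
Definition p_pos := exists q : K, q * p%:R = 1 /\ q \notin vint v.

Definition pth_roots_mod_p := forall y : K, y \in vint v ->
  exists x z : K, [/\ x \in vint v, z \in vint v & x ^+ p = y + p%:R * z].

(** With q = 1/p, both factors of p have value less than v(p). This is the first-order form of v(p)
    not being minimal positive. *)
Definition p_splits := exists a b q : K,
  [/\ q * p%:R = 1, a * b = p%:R, q * a \notin vint v & q * b \notin vint v].

Definition p_pos_formula : formula void 0 :=
  Ex (And (Eq (Mul (Var void ord0) (nat_term void 1 p)) (One void 1))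
          (Not (Int (Var void ord0)))).

Lemma p_pos_formulaP e : holds v (of_void K) p_pos_formula e <-> p_pos.
Proof.
split=> [[q H]|[q [qp nq]]]; exists q.
  by move: H; rewrite /= eval_nat push0 => -[qp /negP nq].
by rewrite /= eval_nat push0; split=> //; apply/negP.
Qed.

(** The implication is coded by negation and conjunction. The innermost quantifier binds [ord0], so
    y, bound outside x and z, is reached by two lifts. *)
Definition pth_roots_formula : formula void 0 :=
  let y := Var void (lift ord0 (lift ord0 ord0)) in
  let x := Var void (lift ord0 ord0) in let z := Var void ord0 in
  all_formula (Not (And (Int (Var void ord0)) (Not (Ex (Ex
    (And (Int x) (And (Int z)
      (Eq (pow_term x p) (Add y (Mul (nat_term void 3 p) z)))))))))).

Lemma pth_roots_formulaP e :
  holds v (of_void K) pth_roots_formula e <-> pth_roots_mod_p.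
Proof.
rewrite holds_all; split=> h y; last first.
  rewrite /= push0 => -[yO]; apply; have [x [z [xO zO xz]]] := h y yO.
  by exists x, z; rewrite eval_pow eval_nat /= !(pushS, push0).
move=> yO; have := h y; rewrite /= push0 => nn; apply: contrapT => nx.
apply: nn; split=> // -[x [z]]; rewrite eval_pow eval_nat /= !(pushS, push0).
by move=> [xO [zO xz]]; apply: nx; exists x, z.
Qed.

Definition p_splits_formula : formula void 0 :=
  let a := Var void (lift ord0 (lift ord0 ord0)) in
  let b := Var void (lift ord0 ord0) in let q := Var void ord0 in
  let P := nat_term void 3 p in
  Ex (Ex (Ex (And (And (Eq (Mul q P) (One void 3)) (Eq (Mul a b) P))
    (And (Not (Int (Mul q a))) (Not (Int (Mul q b))))))).

Lemma p_splits_formulaP e :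
  holds v (of_void K) p_splits_formula e <-> p_splits.
Proof.
split=> -[a [b [q]]]; rewrite /= ?eval_nat ?(pushS, push0).
  by move=> [[qp ab] [/negP qa /negP qb]]; exists a, b, q.
move=> [qp ab qa qb]; exists a, b, q; rewrite eval_nat !(pushS, push0).
by split; split=> //; apply/negP.
Qed.

End Sentences.

Section Transfer.
Variables (p : nat) (K L : fieldType) (v : valuation K) (w : valuation L).
Variables (f : K -> L) (fE : elementary v w f).

Let e0 : 'I_0 -> K := fun i => 0.

Lemma p_pos_transfer : p_pos p v <-> p_pos p w.
Proof.
by rewrite -(p_pos_formulaP p v e0) -(p_pos_formulaP p w (f \o e0)); apply: fE.
Qed.

Lemma pth_roots_transfer : pth_roots_mod_p p v <-> pth_roots_mod_p p w.
Proof.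
rewrite -(pth_roots_formulaP p v e0) -(pth_roots_formulaP p w (f \o e0)).
exact: fE.
Qed.

Lemma p_splits_transfer : p_splits p v <-> p_splits p w.
Proof.
rewrite -(p_splits_formulaP p v e0) -(p_splits_formulaP p w (f \o e0)).
exact: fE.
Qed.

End Transfer.

Section VringVal.
Variables (K : fieldType) (v : valuation K).

Lemma vring_valX (a : vring v) k : vring_val (a ^+ k) = vring_val a ^+ k.
Proof. by elim: k => // k IH; rewrite !exprS -IH. Qed.

Lemma vring_val_nat k : vring_val (k%:R : vring v) = k%:R.
Proof. by elim: k => // k IH; rewrite !mulrS -IH. Qed.

End VringVal.

Section MixedCharacteristicSentences.
Variables (p : nat) (K : fieldType) (v : valuation K) (hp : mixed_char p v).

Lemma mixed_char_prime : prime p.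
Proof. by have /andP[] := hp.2. Qed.

Lemma semiperfectE : semiperfect p (vring_modp hp) <-> pth_roots_mod_p p v.
Proof.
pose Q := vring_modp hp.
split=> [[chp h] y yO|h].
  have [x xy] := h (\pi_Q (VRing yO)).
  move: xy; rewrite pFrobenius_autE -[x]reprK -(rmorphXn \pi_Q) => /eqP.
  rewrite -Quotient.idealrBE unfold_in => /asboolP[b xb].
  have {}xb : vring_val (repr x) ^+ p - y = p%:R * vring_val b.
    by rewrite -vring_valX -(vring_val_nat v) -[RHS]/(vring_val (p%:R * b)) -xb.
  exists (vring_val (repr x)), (vring_val b); split; try exact: valP.
  by rewrite -xb addrC subrK.
have chp : p \in [pchar Q].
  apply/andP; split; first exact: mixed_char_prime.
  rewrite -(rmorph_nat \pi_Q) -(raddf0 \pi_Q) -Quotient.idealrBE subr0 unfold_in.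
  by apply/asboolP; exists 1; rewrite mulr1.
exists chp => y; have [x [z [xO zO xz]]] := h (vring_val (repr y)) (valP (repr y)).
exists (\pi_Q (VRing xO)); rewrite pFrobenius_autE -[y]reprK -(rmorphXn \pi_Q).
apply/eqP; rewrite -Quotient.idealrBE unfold_in; apply/asboolP.
exists (VRing zO); apply: val_inj.
change (vring_val (VRing xO ^+ p) - vring_val (repr y) =
  vring_val (p%:R : vring v) * z).
by rewrite vring_valX vring_val_nat /= xz addrAC subrr add0r.
Qed.

(** If 1/p were integral, p would be a unit in the residue field, where it vanishes. *)
Lemma mixed_char_pos : p_pos p v.
Proof.
have p0 : p%:R != 0 :> K.
  apply/negP => p0; have := hp.1 p; rewrite [RHS]inE => /negP; apply.
  by apply/andP; split; first exact: mixed_char_prime.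
exists p%:R^-1; split; first by rewrite mulVf.
apply/negP => pO; have /andP[_] := hp.2.
rewrite -(rmorph_nat \pi_(residue v)) => /eqP pr0.
have : \pi_(residue v) (VRing pO) * \pi_(residue v) p%:R == 1.
  rewrite -(rmorphM \pi_(residue v)) -(rmorph1 \pi_(residue v)).
  apply/eqP; congr (\pi_(residue v) _); apply: val_inj.
  change (p%:R^-1 * vring_val (p%:R : vring v) = 1).
  by rewrite vring_val_nat mulVf.
by rewrite pr0 mulr0 eq_sym oner_eq0.
Qed.

End MixedCharacteristicSentences.

(** * Ordered groups *)

Section OagMultiples.
Variable G : oagType.
Implicit Types g h : G.

Lemma oag_mulrn_ge0 g n : 0 <= g -> 0 <= g *+ n.
Proof.
move=> g0; elim: n => // n IH.
by rewrite mulrS -[leLHS]addr0 oag_leD.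
Qed.

Lemma oag_ler_mulrn g h n : g <= h -> g *+ n <= h *+ n.
Proof.
by move=> gh; rewrite -oag_subr_ge0 -mulrnBl oag_mulrn_ge0 // oag_subr_ge0.
Qed.

Lemma oag_ler_pmulrn g m n : 0 <= g -> (m <= n)%N -> g *+ m <= g *+ n.
Proof.
by move=> g0 mn; rewrite -oag_subr_ge0 -mulrnBr // oag_mulrn_ge0.
Qed.

Lemma oag_ltD2l h g g' : (h + g < h + g') = (g < g').
Proof. by rewrite !oag_ltNge oag_leD2lE. Qed.

Lemma oag_ltrn_mulrn g h n : g *+ n < h *+ n -> g < h.
Proof. by rewrite !oag_ltNge; apply: contra => /oag_ler_mulrn ->. Qed.

Lemma oag_mulrn_ge0I g n : (0 < n)%N -> 0 <= g *+ n -> 0 <= g.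
Proof.
move=> n0 gn; rewrite oag_leNgt; apply/negP => g0; have {g0} := g0.
rewrite oag_ltNge => /negP; apply.
have [//|g0] := oag_leVge 0 g.
have : g *+ n <= g.
  rewrite -(prednK n0) mulrS -[leRHS]addr0 oag_leD2lE -oag_oppr_ge0 -mulNrn.
  by rewrite oag_mulrn_ge0 // oag_oppr_ge0 ltW.
exact: le_trans.
Qed.

Lemma oag_mulrn_leI g n : (0 < n)%N -> 0 <= g -> g <= g *+ n.
Proof. by move=> n0 g0; rewrite -[leLHS]mulr1n oag_ler_pmulrn. Qed.

End OagMultiples.

Section ConvexHullDivisibility.
Variables (G : oagType) (g0 : G).

Lemma hull_bound g : 0 < g0 -> g \in cvx_hull g0 -> exists n, g <= g0 *+ n.
Proof.
move=> /ltW g0p /asboolP[_ [b /andP[_ gb]]]; exists `|b|%N.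
apply: (le_trans gb); case: b {gb} => n //.
apply: (@le_trans _ _ 0); last by rewrite oag_mulrn_ge0.
by rewrite NegzE mulrNz -oag_oppr_ge0 opprK -pmulrn oag_mulrn_ge0.
Qed.

(** A positive h < g0 gives g0 = h + (g0 - h), a sum of two divisible elements. Subtracting g0
    repeatedly then reduces nonnegative elements of the hull to [0, g0), and quotients stay in the
    hull since 0 <= h <= p h. *)
Lemma pdivisible_hull (p : nat) : (0 < p)%N -> 0 < g0 -> ~ min_positive g0 ->
  (forall g, 0 <= g < g0 -> exists h, h *+ p = g) ->
  forall g, g \in cvx_hull g0 -> exists2 h, h \in cvx_hull g0 & h *+ p = g.
Proof.
move=> p0 g0p nmin div.
have div0 : exists h, h *+ p = g0.
  have [h [hp hlt]] : exists h, 0 < h /\ h < g0.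
    apply: contrapT => nh; apply: nmin; split=> // h hp.
    by rewrite oag_leNgt; apply/negP => hlt; apply: nh; exists h.
  have [h1 E1] : exists h1, h1 *+ p = h by apply: div; rewrite (ltW hp).
  have [|h2 E2] := div (g0 - h).
    rewrite oag_subr_ge0 ltW //= -(oag_ltD2l h) addrC subrK.
    by rewrite -[ltLHS]addr0 [h + _]addrC oag_ltD2l.
  by exists (h1 + h2); rewrite mulrnDl E1 E2 addrC subrK.
have divn n g : 0 <= g <= g0 *+ n -> exists h, h *+ p = g.
  elim: n g => [|n IH] g /andP[gp gn].
    by exists 0; rewrite mul0rn; apply/le_anti; rewrite gp.
  have [gg|gg] := oag_leVge g0 g; last by apply: div; rewrite gp.
  have [|h hE] := IH (g - g0).
    by rewrite oag_subr_ge0 gg -(oag_leD2lE g0) addrC subrK -mulrS.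
  by have [k kE] := div0; exists (h + k); rewrite mulrnDl hE kE subrK.
have main g : 0 <= g -> g \in cvx_hull g0 ->
    exists2 h, h \in cvx_hull g0 & h *+ p = g.
  move=> gp gH; have [n gn] := hull_bound g0p gH.
  have [|h hE] := divn n g; first by rewrite gp.
  have hp : 0 <= h by apply: (oag_mulrn_ge0I p0); rewrite hE.
  exists h => //; apply: convexP (rpred0 _) gH _.
  by rewrite hp -hE oag_mulrn_leI.
move=> g gH; have [gp|/ltW gn] := oag_leVge 0 g; first exact: main.
have [||h hH hE] := main (- g); rewrite ?oag_oppr_ge0 ?rpredN //.
by exists (- h); rewrite ?rpredN // mulNrn hE opprK.
Qed.

(** A convex subgroup avoiding g0 > 0 only has elements strictly between - g0 and g0. If g0 were
    minimal positive, d = g0 - p h would violate this: h <= 0 gives d >= g0, while h >= g0 gives - d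
    >= 2 g0 - g0. *)
Lemma not_min_positive_hull (p : nat) (h : G) : (1 < p)%N -> 0 < g0 ->
  g0 - h *+ p \in max_cvx g0 -> ~ min_positive g0.
Proof.
move=> p1 g0p; set d := _ - _ => dD [_ gmin].
have nd : ~~ ((g0 <= d) || (g0 <= - d)).
  apply/negP => /orP gd; have g0n : g0 != 0 by rewrite gt_eqF.
  have /negP := max_cvx_notin g0n; apply.
  case: gd => gd; first by apply: convexP (rpred0 _) dD _; rewrite ltW.
  have {}dD : - d \in max_cvx g0 by rewrite rpredN.
  by apply: convexP (rpred0 _) dD _; rewrite ltW.
move: nd; rewrite negb_or => /andP[/negP n1 /negP n2].
have [hn|hp] := oag_leVge h 0.
  apply: n1; rewrite /d -[leLHS]addr0 oag_leD2lE -mulNrn.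
  by rewrite oag_mulrn_ge0 // oag_oppr_ge0.
apply: n2; rewrite /d opprB -(oag_leD2rE g0) subrK -mulr2n.
apply: (@le_trans _ _ (h *+ 2)); first exact/oag_ler_mulrn/gmin.
by rewrite oag_ler_pmulrn ?ltW.
Qed.

End ConvexHullDivisibility.

(** * Values, residues and coarsenings *)

Section ValuationFacts.
Variables (K : fieldType) (v : valuation K).
Implicit Types x y : K.

Lemma ele_anti (G : oagType) (a b : option G) : ele a b -> ele b a -> a = b.
Proof.
case: a b => [g|] [h|] //= gh hg; congr Some.
by apply/le_anti; rewrite gh.
Qed.

Lemma val_neq0P x g : v x = Some g -> x != 0.
Proof. by move=> vx; apply/eqP => /(val_eq0 v); rewrite vx. Qed.

Lemma valX x g k : v x = Some g -> v (x ^+ k) = Some (g *+ k).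
Proof. by move/(valXz k). Qed.

Lemma valD_lt x y : elt (v x) (v y) -> v (x + y) = v x.
Proof.
move=> xy; apply: ele_anti; last first.
  by apply: ele_trans (valD v x y); rewrite ele_emin ?ele_refl ?elt_le.
have := valD v (x + y) (- y); rewrite addrK valN /emin.
by case: ifP => // _ yx; move: xy; rewrite /elt yx.
Qed.

Lemma vint_ge0 x g : v x = Some g -> (x \in vint v) = (0 <= g).
Proof. by move=> vx; rewrite unfold_in /vint vx. Qed.

Lemma vintVr x : x \notin vint v -> x^-1 \in vint v.
Proof.
move=> xO; have x0 : x != 0 by apply: contraNneq xO => ->; rewrite rpred0.
have [g vx] := val_neq0 v x0.
move: xO; rewrite (vint_ge0 vx) (vint_ge0 (valV vx)) -oag_ltNge oag_oppr_ge0.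
exact: ltW.
Qed.

(** The residue map is made total on [K], with value 0 outside the valuation ring, to compute
    residues without carrying integrality proofs in the terms. *)
Definition res (x : K) : residue v := \pi_(residue v) (insubd (0 : vring v) x).

Lemma res_pi (a : vring v) : res (vring_val a) = \pi_(residue v) a.
Proof. by rewrite /res; congr (\pi_(residue v) _); apply: valKd. Qed.

Lemma resP (r : residue v) : exists2 x, x \in vint v & res x = r.
Proof.
exists (vring_val (repr r)); first exact: (valP (repr r)).
by rewrite res_pi reprK.
Qed.

Lemma res_inP x : x \in vint v ->
  exists2 a : vring v, vring_val a = x & res x = \pi_(residue v) a.
Proof. by move=> xO; exists (VRing xO); rewrite // -res_pi. Qed.

Lemma resD x y : x \in vint v -> y \in vint v -> res (x + y) = res x + res y.
Proof.
move=> /res_inP[a <- ->] /res_inP[b <- ->].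
by rewrite -(raddfD \pi_(residue v)); apply: (res_pi (a + b)).
Qed.

Lemma resM x y : x \in vint v -> y \in vint v -> res (x * y) = res x * res y.
Proof.
move=> /res_inP[a <- ->] /res_inP[b <- ->].
by rewrite -(rmorphM \pi_(residue v)); apply: (res_pi (a * b)).
Qed.

Lemma res1 : res 1 = 1.
Proof. by rewrite -(rmorph1 \pi_(residue v)); apply: (res_pi 1). Qed.

Lemma resX x k : x \in vint v -> res (x ^+ k) = res x ^+ k.
Proof.
move=> xO; elim: k => [|k IH]; first exact: res1.
by rewrite !exprS resM ?IH ?rpredX.
Qed.

Lemma res_nat k : res k%:R = k%:R.
Proof.
by rewrite -(rmorph_nat \pi_(residue v)) -(vring_val_nat v); apply: res_pi.
Qed.

Lemma res_eq0 x : x \in vint v -> (res x == 0) = elt (Some 0) (v x).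
Proof. by move=> /res_inP[a <- ->]; rewrite residue_eq0. Qed.

Lemma residue_pchar p : prime p -> elt (Some 0) (v p%:R) ->
  p \in [pchar (residue v)].
Proof.
by move=> pp vp; apply/andP; split; rewrite // -res_nat res_eq0 // rpred_nat.
Qed.

End ValuationFacts.

Lemma sg_valMn (G : oagType) (H : zmodClosed G) (h : subgroup H) n :
  sg_val (h *+ n) = sg_val h *+ n.
Proof. by elim: n => // n IH; rewrite !mulrS -IH. Qed.

Section Coarsenings.
Variables (K : fieldType) (v : valuation K) (D : convexSubgroup (vgroup v)).

Lemma coarsen_elt x y : elt (coarsen D x) (coarsen D y) -> elt (v x) (v y).
Proof. by rewrite /elt; apply: contra => /(ele_omap_pi D). Qed.

Lemma coarsen_eq_some0 x g : v x = Some g -> coarsen D x = Some 0 <-> g \in D.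
Proof.
move=> vx; rewrite /= /coarsen_fun vx /= -(raddf0 \pi_(gquot D)).
split=> [[/eqP]|gD]; first by rewrite gquot_eqE subr0.
by congr Some; apply/eqP; rewrite gquot_eqE subr0.
Qed.

(** The units of the coarsened ring are the elements with value in D, so the induced value group is
    D itself. *)
Lemma mem_induced_coarsen (g : vgroup v) :
  (g \in induced_subgroup v (coarsen D)) = (g \in D).
Proof.
apply/asboolP/idP => [[x wx vx]|gD]; first by apply/(coarsen_eq_some0 vx).
by have [x vx] := val_surj g; exists x => //; apply/(coarsen_eq_some0 vx).
Qed.

Lemma pdivisible_induced p (vw : coarsening v (coarsen D)) :
  pdivisible p (vgroup (induced vw)) <->
  forall g, g \in D -> exists2 h, h \in D & h *+ p = g.
Proof.
split=> [div g gD|div g].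
  have gI : g \in induced_subgroup v (coarsen D) by rewrite mem_induced_coarsen.
  have [h /(congr1 (@sg_val _ _)) hE] := div (Subgroup gI).
  by exists (sg_val h); rewrite -?mem_induced_coarsen ?(valP h) // -sg_valMn hE.
have [|h hD hE] := div (sg_val g); first by rewrite -mem_induced_coarsen (valP g).
have hI : h \in induced_subgroup v (coarsen D) by rewrite mem_induced_coarsen.
by exists (Subgroup hI); apply: val_inj; rewrite /= sg_valMn.
Qed.

Variables (E : convexSubgroup (vgroup v)).

(** Here the induced value group is D/E; the inclusion of E in D makes membership independent of the
    representative. *)
Lemma mem_induced_coarsen2 (g : vgroup v) : {subset E <= D} ->
  (\pi_(gquot E) g \in induced_subgroup (coarsen E) (coarsen D)) = (g \in D).
Proof.
move=> ED; apply/asboolP/idP => [[x wx]|gD].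
  rewrite /= /coarsen_fun; case vx : (v x) => [h|//] [] /eqP.
  rewrite gquot_eqE => /ED hg; rewrite -[g](subKr h) rpredB //.
  exact/(coarsen_eq_some0 vx).
have [x vx] := val_surj g; exists x; first exact/(coarsen_eq_some0 vx).
by rewrite /= /coarsen_fun vx.
Qed.

Lemma pdivisible_induced2 p (ED : {subset E <= D})
    (vw : coarsening (coarsen E) (coarsen D)) :
  pdivisible p (vgroup (induced vw)) <->
  forall g, g \in D -> exists2 h, h \in D & g - h *+ p \in E.
Proof.
split=> [div g gD|div g].
  have gI : \pi_(gquot E) g \in induced_subgroup (coarsen E) (coarsen D).
    by rewrite mem_induced_coarsen2.
  have [h /(congr1 (@sg_val _ _)) hE] := div (Subgroup gI).
  have := valP h; rewrite /= -[sg_val h]reprK mem_induced_coarsen2 // => hD.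
  exists (repr (sg_val h)); rewrite // -gquot_eqE raddfMn.
  by rewrite [X in _ == X *+ p]reprK -sg_valMn hE.
have [|h hD hE] := div (repr (sg_val g)).
  by rewrite -mem_induced_coarsen2 // reprK; apply: valP g.
have hI : \pi_(gquot E) h \in induced_subgroup (coarsen E) (coarsen D).
  by rewrite mem_induced_coarsen2.
exists (Subgroup hI); apply: val_inj.
rewrite /= sg_valMn -[sg_val g]reprK /= -raddfMn.
by apply/esym/eqP; rewrite gquot_eqE.
Qed.

End Coarsenings.

(** * Consequences of p-th roots modulo p *)

Section PositiveP.
Variables (p : nat) (K : fieldType) (v : valuation K).
Hypotheses (p_prime : prime p) (p_gt0 : p_pos p v).
Local Notation g0 := (pval p v).
Local Notation w := (coarsep p v).

Let p0 : p%:R != 0 :> K.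
Proof.
apply/eqP => p0; have [q [/eqP]] := p_gt0.
by rewrite p0 mulr0 eq_sym oner_eq0.
Qed.

Lemma val_p : v p%:R = Some g0.
Proof. by have [g vg] := val_neq0 v p0; rewrite /pval vg. Qed.

Lemma pval_gt0 : 0 < g0.
Proof.
have [q [qp]] := p_gt0; have -> : q = p%:R^-1 by rewrite -[q](mulfK p0) qp mul1r.
by rewrite (vint_ge0 (valV val_p)) oag_oppr_ge0 -oag_ltNge.
Qed.

Lemma coarsep_p : elt (Some 0) (w p%:R).
Proof.
have [] := coarsep_coarsest p0 (v := v) => //.
by rewrite val_p /elt /= -oag_ltNge pval_gt0.
Qed.

(** The two values add up to v(p) and are both smaller, hence both are positive. Conversely, a with
    0 < v(a) < v(p) gives p = a (p/a). *)
Lemma p_splitsE : p_splits p v <-> ~ min_positive g0.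
Proof.
have div_lt a g : v a = Some g -> (p%:R^-1 * a \notin vint v) = (g < g0).
  move=> va; rewrite (@vint_ge0 _ v _ (- g0 + g)).
    by rewrite addrC oag_subr_ge0 -oag_ltNge.
  by rewrite (valM v) (valV val_p) va.
split=> [[a [b [q [qp ab qa qb]]]] [_ gmin]|nmin].
  have qE : q = p%:R^-1 by rewrite -[q](mulfK p0) qp mul1r.
  have [a0 b0] : a != 0 /\ b != 0.
    by apply/andP; rewrite -negb_or -mulf_eq0 ab.
  have [[g va] [h vb]] := (val_neq0 v a0, val_neq0 v b0).
  rewrite qE (div_lt _ _ va) in qa; rewrite qE (div_lt _ _ vb) in qb.
  have gh : g + h = g0.
    by apply: Some_inj; rewrite -val_p -ab (valM v) va vb.
  have /gmin : 0 < g by rewrite -(oag_ltD2l h) addr0 addrC gh.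
  by rewrite oag_leNgt qa.
have [h [hp hlt]] : exists h, 0 < h /\ h < g0.
  apply: contrapT => nh; apply: nmin; split=> [|h hp]; first exact: pval_gt0.
  by rewrite oag_leNgt; apply/negP => hlt; apply: nh; exists h.
have [a va] := val_surj h; have a0 := val_neq0P va.
exists a, (p%:R / a), p%:R^-1; split; rewrite ?mulVf //.
- by rewrite mulrCA divff // mulr1.
- by rewrite (div_lt _ _ va).
rewrite (div_lt _ (g0 - h)); last by rewrite (valM v) val_p (valV va).
by rewrite -(oag_ltD2l h) [h + _]addrC subrK -[ltLHS]add0r ![_ + g0]addrC oag_ltD2l.
Qed.

(** In x^p = y + p z the error has value at least v(p) > v(y), so p v(x) = v(y). *)
Lemma pth_roots_pdivisible : pth_roots_mod_p p v ->
  forall g, 0 <= g < g0 -> exists h, h *+ p = g.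
Proof.
move=> roots g /andP[gp glt]; have [y vy] := val_surj g.
have [|x [z [xO zO xz]]] := roots y; first by rewrite (vint_ge0 vy).
have vxp : v (x ^+ p) = Some g.
  rewrite xz valD_lt vy // (valM v) val_p.
  move: zO; rewrite unfold_in /vint /elt; case: (v z) => //= h hp.
  rewrite -oag_ltNge (lt_le_trans glt) //.
  by rewrite -[leLHS]addr0 oag_leD2lE.
have x0 : x != 0.
  apply: contra_eqN vxp => /eqP ->.
  by rewrite expr0n eqn0Ngt prime_gt0 // val0.
have [h vh] := val_neq0 v x0; exists h.
by apply: Some_inj; rewrite -vxp (valX _ vh).
Qed.

(** Since p vanishes in the residue field of [w], roots modulo p become exact there. Residues of
    elements outside the ring of v are handled through their inverses, which lie in it. *)
Lemma pth_roots_perfect : pth_roots_mod_p p v -> perfect (residue w).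
Proof.
move=> roots q chq y; suff [x <-] : exists x, x ^+ q = y by exists x.
have chp : p \in [pchar (residue w)] by apply: residue_pchar => //; exact: coarsep_p.
have /eqP -> : q == p.
  by have := pcharf_eq chq p; rewrite chp inE => /esym; rewrite eq_sym.
have vw : {subset vint v <= vint w} by exact: coarseningp.
have root a : a \in vint v -> exists x, x ^+ p = res w a.
  move=> aO; have [x [z [xO zO xz]]] := roots a aO.
  exists (res w x); rewrite -resX ?vw // xz.
  rewrite resD ?resM ?vw ?rpred_nat ?rpredM ?rpred_nat //.
  have /eqP -> : res w p%:R == 0 by rewrite res_eq0 ?rpred_nat // coarsep_p.
  by rewrite mul0r addr0.
have [a aO <-] := resP y; have [/root//|aN] := boolP (a \in vint v).
have a0 : a != 0 by apply: contraNneq aN => ->; rewrite rpred0.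
have aVO := vintVr aN; have [x xE] := root _ aVO; exists x^-1.
have aI : res w a * res w a^-1 = 1 by rewrite -resM ?(vw _ aVO) // divff // res1.
have aV0 : res w a^-1 != 0.
  by apply: contra_eq_neq aI => ->; rewrite mulr0 eq_sym oner_neq0.
by rewrite exprVn xE; apply: (mulIf aV0); rewrite mulVf.
Qed.

End PositiveP.

(** * Existence of p-th roots modulo p *)

(** The inner binomial coefficients are divisible by p. The factor d is kept because the error is
    later estimated by the value of p d. *)
Lemma expr_primeD (R : comNzRingType) p (x d : R) : prime p ->
  exists r, (x + d) ^+ p = x ^+ p + d ^+ p + p%:R * (d * r).
Proof.
move=> pp; case: p pp => // n pp.
rewrite exprDn big_ord_recl big_ord_recr /= subn0 bin0 mulr1n expr0 mulr1.
rewrite /bump leq0n add1n subnn binn mulr1n expr0 mul1r.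
set S := \sum_(i < n) _; suff [r ->] : exists r, S = n.+1%:R * (d * r).
  by exists r; rewrite -addrA [_ + d ^+ _]addrC.
rewrite /S; apply: (big_ind (fun s => exists r, s = n.+1%:R * (d * r))).
- by exists 0; rewrite !mulr0.
- by move=> _ _ [r ->] [s ->]; exists (r + s); rewrite !mulrDr.
move=> i _; rewrite leq0n add1n; have /dvdnP[k ->] : (n.+1 %| 'C(n.+1, i.+1))%N.
  by apply: prime_dvd_bin; rewrite //= ltnS.
exists (x ^+ (n.+1 - i.+1) * d ^+ i *+ k).
by rewrite exprS mulrnA -[LHS]mulr_natl !mulrnAr [x ^+ _ * (d * _)]mulrCA.
Qed.

Lemma elt_eaddl (G : oagType) (g : G) a b :
  elt (eadd (Some g) a) (eadd (Some g) b) = elt a b.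
Proof. by case: a b => [x|] [y|] //=; rewrite /elt /= oag_leD2lE. Qed.

(** The conditions form a type over the countable parameter set made of y and all [c m], and a
    finite part of it involves only indices below some n. *)
Lemma aleph1_saturated_seq (K : fieldType) (v : valuation K) (p : nat) (y : K)
    (c : nat -> K) : aleph1_saturated v ->
  (forall n, exists2 x, x \in vint v &
     forall m, (m < n)%N -> (x ^+ p - y) * c m \in vint v) ->
  exists2 x, x \in vint v & forall m, (x ^+ p - y) * c m \in vint v.
Proof.
move=> sat fin; pose A := range (fun m => if m is m'.+1 then c m' else y).
have Ay : A y by exists 0%N.
have Ac m : A (c m) by exists m.+1.
pose X := Var {a | A a} (ord0 : 'I_1).
pose F m := And (Int X) (Int (Mul
  (Add (pow_term X p) (Opp (Cst 1 (exist A y Ay)))) (Cst 1 (exist A (c m) (Ac m))))).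
have FE m x : holds v sval (F m) (fun=> x) <->
    x \in vint v /\ (x ^+ p - y) * c m \in vint v.
  by rewrite /= eval_pow.
have Acount : countable A.
  by apply: (card_le_trans (card_image_le _ _)); apply: card_lexx.
have [Psi PsiF Psi_fin|x xP] := sat A Acount (range F).
  have [n nP] : exists n, forall phi, Psi phi -> exists2 m, (m < n)%N & phi = F m.
    (* Each formula of [Psi] gets an index, any other formula the index 0; n is then one more than
       the largest index on [Psi]. *)
    have /choice[g gP] (phi : formula {a | A a} 1) : exists m, Psi phi -> phi = F m.
      by have [/PsiF[m _ <-]|] := pselect (Psi phi); [exists m|exists 0%N].
    have /finite_seqP[s sE] := finite_image g Psi_fin.
    exists (\max_(i <- s) i).+1 => phi Pphi; exists (g phi); last exact: gP.
    rewrite ltnS; apply: leq_bigmax_seq => //.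
    by have : (g @` Psi) (g phi); [apply: imageP|rewrite sE].
  have [x xO xP] := fin n; exists x => phi /nP[m lt_mn ->].
  by apply/FE; split=> //; apply: xP.
exists x => [|m]; have := xP (F 0%N) (imageP _ I); first by move=> /FE[].
by have /FE[] := xP (F m) (imageP _ I).
Qed.

Section SaturatedConverse.
Variables (p : nat) (K : fieldType) (v : valuation K).
Hypotheses (p_prime : prime p) (p_gt0 : p_pos p v).
Local Notation g0 := (pval p v).
Local Notation w := (coarsep p v).
Hypothesis w_perfect : perfect (residue w).
Hypothesis hull_div : forall g, g \in cvx_hull g0 ->
  exists2 h, h \in cvx_hull g0 & g - h *+ p \in max_cvx g0.

(** Divisibility modulo [max_cvx g0] writes e = c^p t with w(t) = 0. Perfectness gives b with b^p
    and - t of equal residue, and d = c b works. *)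
Lemma approx_pth_root (e : K) g : v e = Some g -> g \in cvx_hull g0 ->
  exists d, elt (w e) (w (e + d ^+ p)).
Proof.
move=> ve /hull_div[h _ hD]; have [c vc] := val_surj h.
have cp0 : c ^+ p != 0 by rewrite expf_neq0 // (val_neq0P vc).
pose t := e / c ^+ p; have eE : e = c ^+ p * t by rewrite mulrC divfK.
have vt : v t = Some (g - h *+ p).
  by rewrite /t (valM v) ve (valV (valX p vc)).
have wt : w t = Some 0 by apply/(coarsen_eq_some0 _ vt).
clearbody t.
have tO : t \in vint w by rewrite unfold_in /vint wt ele_refl.
have chp : p \in [pchar (residue w)] by apply: residue_pchar => //; apply: coarsep_p.
have [r] := w_perfect chp (res w (- t)); have [b bO <-] := resP r.
rewrite pFrobenius_autE -resX // => tb; exists (c * b).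
have -> : e + (c * b) ^+ p = c ^+ p * (t + b ^+ p) by rewrite exprMn mulrDr -eE.
rewrite {1}eE !(valM w).
have [k ->] := val_neq0 w cp0; rewrite elt_eaddl wt -res_eq0 ?rpredD ?rpredX //.
rewrite resD ?rpredX // tb -resD ?rpredN // subrr -[_ == _]/(res w 0 == 0).
by rewrite res_eq0 ?rpred0 // val0.
Qed.

(** The new point is x + d with d^p close to - e. Its error is (e + d^p) + p d r, so beyond the
    choice of d it remains to see that w(p d) > w(e). *)
Lemma approx_pth_root_step (x y : K) g : x \in vint v ->
    v (x ^+ p - y) = Some g -> 0 <= g < g0 ->
  exists2 x', x' \in vint v & elt (w (x ^+ p - y)) (w (x' ^+ p - y)).
Proof.
move=> xO; set e := x ^+ p - y => ve /andP[gp glt].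
have gH : g \in cvx_hull g0.
  apply: convexP (rpred0 _) (cvx_hull_id g0) _.
  by rewrite gp ltW.
have [d wd] := approx_pth_root ve gH.
(* In d^p = - e + (e + d^p) the second summand has larger value; hence p v(d) = g, and d is
   integral. *)
have vdp : v (d ^+ p) = Some g.
  rewrite -[d ^+ p](addKr e) valD_lt valN // ve -ve.
  exact: coarsen_elt wd.
have d0 : d != 0.
  by apply: contra_eq_neq vdp => ->; rewrite expr0n eqn0Ngt prime_gt0 // val0.
have [k vd] := val_neq0 v d0.
have kg : k *+ p = g by apply: Some_inj; rewrite -vdp (valX p vd).
have kp : 0 <= k by apply: (oag_mulrn_ge0I (prime_gt0 p_prime)); rewrite kg.
have dO : d \in vint v by rewrite (vint_ge0 vd).
exists (x + d); first by rewrite rpredD.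
have [r rE] := expr_primeD (VRing xO) (VRing dO) p_prime.
have {}rE : (x + d) ^+ p = x ^+ p + d ^+ p + p%:R * (d * vring_val r).
  have := congr1 (@vring_val _ _) rE; rewrite vring_valX => ->.
  rewrite -[x in RHS]/(vring_val (VRing xO)) -[d in RHS]/(vring_val (VRing dO)).
  by rewrite -!vring_valX -(vring_val_nat v).
have -> : (x + d) ^+ p - y = (e + d ^+ p) + p%:R * d * vring_val r.
  by rewrite rE mulrA addrAC; congr (_ + _); rewrite addrAC.
apply: elt_le_trans (valD w _ _); apply: elt_emin => //.
have wr : ele (Some 0) (w (vring_val r)) by apply: coarseningp; apply: (valP r).
have [wpd|] : elt (w e) (w (p%:R * d)) \/ ele (w (p%:R * d)) (w e).
- by rewrite /elt; case: ele; [right|left].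
- apply: (elt_le_trans wpd); rewrite (valM w (p%:R * d)).
  case: (w (p%:R * d)) (w _) wr => [?|] [?|] //= ?.
  by rewrite -[leLHS]addr0 oag_leD2lE.
rewrite /= /coarsen_fun (valM v) (val_p p_gt0) vd ve /=.
rewrite -oag_subr_ge0 -raddfB gquot_ge0E oag_subr_ge0 => /orP[gk|gD].
  have : g0 <= g by apply: le_trans gk; rewrite -[leLHS]addr0 oag_leD2lE.
  by rewrite oag_leNgt glt.
(* The remaining case has k + (g0 - g) in the convex subgroup. Both summands are nonnegative, so k
   lies in it, then g = p k and finally g0, which is excluded. *)
have gD' : g0 + k - g \in max_cvx g0 by rewrite -opprB rpredN.
have g0g : 0 <= g0 - g by rewrite oag_subr_ge0 ltW.
have kD : k \in max_cvx g0.
  apply: convexP (rpred0 _) gD' _.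
  by rewrite kp addrAC -[leLHS]add0r oag_leD2rE.
have g0D : g0 \in max_cvx g0.
  have : (g0 + k - g) - k + k *+ p \in max_cvx g0.
    by apply: rpredD; [apply: rpredB|apply: rpredMn].
  by rewrite kg -addrA [- k + g]addrC addrA subrK addrK.
have : g0 != 0 by rewrite gt_eqF // pval_gt0.
by move=> /max_cvx_notin; rewrite g0D.
Qed.

(* If no x solves x^p = y modulo p, the values of x^p - y have no maximum modulo
   the largest convex subgroup D avoiding v(p), and as the convex hull of v(p) is
   archimedean modulo D, countably many of them, those of the elements X (k, n)
   below, are cofinal. Saturation yields an x above all these. *)
Lemma saturated_pth_roots : aleph1_saturated v -> pth_roots_mod_p p v.
Proof.
move=> sat y yO; apply: contrapT => noroot.
have g0p := pval_gt0 p_gt0; have vp := val_p p_gt0.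
pose E x := x ^+ p - y; pose gam x := odflt 0 (v (E x)).
(* An error of value at least v(p), in particular a zero error, would make x a root modulo p. The
   default in [gam] is thus never read at an integral x. *)
have E_lt x : x \in vint v -> v (E x) = Some (gam x) /\ 0 <= gam x < g0.
  move=> xO; have EO : E x \in vint v by rewrite rpredB ?rpredX.
  have EpO : p%:R^-1 * E x \notin vint v.
    apply/negP => zO; apply: noroot; exists x, (p%:R^-1 * E x); split=> //.
    by rewrite mulrA divff ?(val_neq0P vp) // mul1r addrC subrK.
  have Ex0 : E x != 0 by apply: contraNneq EpO => ->; rewrite mulr0 rpred0.
  have [g vE] := val_neq0 v Ex0; have gE : gam x = g by rewrite /gam vE.
  rewrite gE vE; split=> //; rewrite -(vint_ge0 vE) EO /=.
  move: EpO; rewrite (@vint_ge0 _ v _ (- g0 + g)).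
    by rewrite addrC oag_subr_ge0 -oag_ltNge.
  by rewrite (valM v) (valV vp) vE.
have improve x : x \in vint v ->
    exists2 x', x' \in vint v &
      exists2 a, gam x' = gam x + a & 0 < a /\ a \notin max_cvx g0.
  move=> xO; have [vE gE] := E_lt x xO.
  have [x' x'O lt_w] := approx_pth_root_step xO vE gE; exists x' => //.
  have [vE' _] := E_lt x' x'O.
  exists (gam x' - gam x); first by rewrite addrC subrK.
  move: lt_w; rewrite -!/(E _) /= /coarsen_fun vE vE' /elt /=.
  rewrite -oag_subr_ge0 -raddfB gquot_ge0E negb_or -oag_ltNge.
  rewrite -opprB rpredN => /andP[lt0 nD]; split=> //.
  by rewrite oag_ltNge -oag_oppr_ge0 -oag_ltNge.
(* For n > 0, [X (k, n)] has [gam] at least (k/n) g0 whenever some integral element does; otherwise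
   it is 0, chosen only to be integral. *)
have /choice[X XP] (m : nat * nat) : exists x, x \in vint v /\
    forall x', x' \in vint v -> g0 *+ m.1 <= gam x' *+ m.2 ->
      g0 *+ m.1 <= gam x *+ m.2.
  have [[x [xO xm]]|nx] :=
      pselect (exists x, x \in vint v /\ g0 *+ m.1 <= gam x *+ m.2).
    by exists x; split=> // x' _ _.
  by exists 0; split=> [|x' x'O x'm]; [exact: rpred0|case: nx; exists x'].
(* An improvement x' satisfies n gam x' >= n gam x + g0 for some n. With k the largest integer such
   that k g0 <= n gam x', it follows that n gam x < k g0 <= n gam (X (k, n)). *)
have cofinal x : x \in vint v -> exists m, gam x < gam (X m).
  move=> xO; have [x' x'O [a gE [ap aD]]] := improve x xO.
  have [n na] : exists n, g0 <= a *+ n.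
    apply: hull_bound => //; have [//|aN] := boolP (g0 \in cvx_hull a).
    by rewrite (max_cvx_max aN (cvx_hull_id a)) in aD.
  have [_ /andP[gp glt]] := E_lt x' x'O.
  have ex_k : exists k, g0 *+ k <= gam x' *+ n.
    by exists 0%N; rewrite mulr0n oag_mulrn_ge0.
  have k_le k : g0 *+ k <= gam x' *+ n -> (k <= n)%N.
    move=> kn; rewrite leqNgt; apply/negP => lt_nk.
    have : g0 *+ n.+1 <= g0 *+ n.
      apply: le_trans (oag_ler_mulrn n (ltW glt)); apply: le_trans kn.
      by rewrite oag_ler_pmulrn // ltW.
    by rewrite mulrS -[leRHS]add0r oag_leD2rE oag_leNgt g0p.
  case: (ex_maxnP ex_k k_le) => k kn kmax.
  have [_ Xm] := XP (k, n); exists (k, n); apply: (@oag_ltrn_mulrn _ _ _ n).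
  apply: lt_le_trans (Xm x' x'O kn) => /=.
  have lt_k : gam x' *+ n < g0 *+ k.+1.
    by rewrite oag_ltNge; apply/negP => /kmax; rewrite ltnn.
  move: lt_k; rewrite gE mulrnDl mulrS [gam x *+ n + _]addrC => lt_k.
  rewrite -(oag_ltD2l g0). apply: (le_lt_trans _ lt_k).
  by rewrite oag_leD2rE.
pose d i := X (odflt (0%N, 0%N) (unpickle i)).
have dO i : d i \in vint v by have [] := XP (odflt (0%N, 0%N) (unpickle i)).
(* Comparing [gam] is divisibility by [E (d i)], the form that [aleph1_saturated_seq] accepts. *)
have dE x i : x \in vint v ->
    ((x ^+ p - y) * (E (d i))^-1 \in vint v) = (gam (d i) <= gam x).
  move=> xO; have [[vx _] [vd _]] := (E_lt x xO, E_lt _ (dO i)).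
  rewrite (@vint_ge0 _ v _ (gam x - gam (d i))) ?oag_subr_ge0 //.
  by rewrite (valM v) (valV vd) [v _]vx.
have [|x xO xP] := @aleph1_saturated_seq _ v p y (fun i => (E (d i))^-1) sat.
  (* Finitely many conditions are met by keeping the better of the point found so far and [d n]. *)
  elim=> [|n [x xO xP]]; first by exists 0; rewrite ?rpred0.
  have le_x m : (m < n)%N -> gam (d m) <= gam x by move=> lt_mn; rewrite -dE ?xP.
  have [xn|nx] := oag_leVge (gam (d n)) (gam x).
    exists x => // m; rewrite ltnS leq_eqVlt dE // => /predU1P[->//|]; exact: le_x.
  exists (d n) => // m; rewrite ltnS leq_eqVlt dE // => /predU1P[->//|/le_x mx].
  exact: le_trans mx (ltW nx).
have [m] := cofinal x xO; rewrite oag_ltNge => /negP; apply.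
by have := xP (pickle m); rewrite dE // /d pickleK.
Qed.

End SaturatedConverse.

(** * Equivalence of the three conditions *)

Theorem theorem4p15 (p : nat) (K : fieldType) (v : valuation K)
    (hp : mixed_char p v) :
  [<-> semiperfect p (vring_modp hp) /\ ~ min_positive (pval p v);
       forall (K' : fieldType) (v' : valuation K') (f : K -> K'),
         elementary v v' f ->
         perfect (residue (coarsep p v')) /\
         pdivisible p (vgroup (induced (@coarsening0 p K' v')));
       exists (K' : fieldType) (v' : valuation K') (f : K -> K'),
         [/\ elementary v v' f, aleph1_saturated v',
             perfect (residue (coarsep p v')) &
             pdivisible p (vgroup (induced (@coarseningp0 p K' v')))]].
Proof.
have pp := mixed_char_prime hp; have pv := mixed_char_pos hp.
tfae.
- move=> [/semiperfectE roots /(p_splitsE pv) split_p] L w f fE.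
  have pw := (p_pos_transfer p fE).1 pv.
  have {}roots := (pth_roots_transfer p fE).1 roots.
  have {split_p}/(p_splitsE pw) nmin := (p_splits_transfer p fE).1 split_p.
  split; first exact: pth_roots_perfect.
  apply/pdivisible_induced; apply: pdivisible_hull => //.
  + exact: prime_gt0.
  + exact: pval_gt0.
  + exact: pth_roots_pdivisible.
(* An ultrafilter refining the cofinite filter is nonprincipal, which is what the saturation of its
   ultrapower requires. *)
- have [U [FU oU]] := @ultraFilterLemma nat \oo _.
  move=> /(_ _ _ _ (elementary_upow FU v))[perf /pdivisible_induced div].
  exists (upow FU K), (upow_val FU v), (fun x => \pi_(upow FU K) (fun=> x)).
  split=> //; [exact: elementary_upow|exact: aleph1_saturated_upow|].
  apply/pdivisible_induced2 => [|g /div[h hH <-]]; first exact: max_cvx_hull.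
  by exists h; rewrite // subrr rpred0.
(* Elementarity works in both directions, so the sentences expressing (i) need only be checked in
   the saturated extension. *)
move=> [L [w [f [fE sat perf /(pdivisible_induced2 _ (@max_cvx_hull _ _)) div]]]].
have pw := (p_pos_transfer p fE).1 pv; split.
  apply/semiperfectE/(pth_roots_transfer p fE).
  exact: saturated_pth_roots.
apply/(p_splitsE pv)/(p_splits_transfer p fE)/(p_splitsE pw).
(* Dividing v(p) itself by p, up to the convex subgroup, already excludes that it is minimal
   positive. *)
have [h _ hD] := div _ (cvx_hull_id _).
apply: not_min_positive_hull hD; first exact: prime_gt1.
exact: pval_gt0.
Qed.
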